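(* Let $\mathbb{F}$ be a field and, for $n\ge2$, let $K_2\times K_n$ be the graph with vertices $\{x_1,\ldots,x_n\}\cup\{y_1,\ldots,y_n\}$ and edges $\{x_i,x_j\}$ and $\{y_i,y_j\}$ for $1\le i<j\le n$, and $\{x_i,y_i\}$ for $1\le i\le n$. (1) $\mathbb{F}[\Delta_2^t(K_2\times K_2)]$ has a linear resolution with Betti numbers $\beta_{1,2}=\beta_{2,3}=4$ and $\beta_{0,0}=\beta_{3,4}=1$. The ring $\mathbb{F}[\Delta_2^t(K_2\times K_2)^\vee]$ is, after naming the vertices of the $4$-cycle $K_2\times K_2$ in cyclic order $x_1,x_2,x_3,x_4$, the complete intersection $\mathbb{F}[x_1,x_2,x_3,x_4]/(x_1x_3,\,x_2x_4)$, with Betti numbers $\beta_{1,2}=2$ and $\beta_{0,0}=\beta_{2,4}=1$. (2) If $n>2$, then neither $\mathbb{F}[\Delta_2^t(K_2\times K_n)]$ nor $\mathbb{F}[\Delta_2^t(K_2\times K_n)^\vee]$ is Cohen-Macaulay, and neither has a linear resolution.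
   Context: A simplicial complex on a finite set $V$ is a collection of subsets of $V$ closed under taking subsets (an element of $V$ need not itself be a face). Its Stanley-Reisner ring over $\mathbb{F}$ is $\mathbb{F}[\Delta]=S/I_\Delta$, where $S$ is the polynomial ring over $\mathbb{F}$ with one variable $x_v$ for each $v\in V$ and $I_\Delta$ is generated by the monomials $\prod_{v\in F}x_v$ for all $F\subseteq V$ with $F\notin\Delta$ (variables may be denoted by the same symbol as the vertices). For a finite simple graph $G=(V,E)$ and a positive integer $k$, $\Delta_k^t(G)$ is the simplicial complex on $V$ whose facets are the complements $V\setminus M$ of the independent sets $M\subseteq V$ of size $k$ (independent: no two elements adjacent). The Alexander dual of $\Delta$ is $\Delta^\vee=\{F\subseteq V : V\setminus F\notin\Delta\}$, a complex on the same set $V$. For a homogeneous ideal $I\subseteq S$, $\beta_{i,j}=\dim_{\mathbb{F}}\mathrm{Tor}^S_i(S/I,\mathbb{F})_j$ are the graded Betti numbers of $S/I$; when Betti numbers of a ring are listed, all Betti numbers not listed are zero. $S/I$ has an $s$-linear resolution if $I$ is generated in degree $s$ and $\beta_{i,j}=0$ whenever $i\ge1$ and $j\ne s+i-1$; it has a linear resolution if it has an $s$-linear resolution for some $s\ge 1$. *)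

(* Defs.v *)
From HB Require Import structures.
From mathcomp Require Import all_boot all_order all_algebra.
From mathcomp.multinomials Require Import mpoly.

Set Implicit Arguments.
Unset Strict Implicit.
Unset Printing Implicit Defensive.

Import GRing.Theory.
Local Open Scope ring_scope.

(* An ideal of R is a predicate R -> Prop.  A quotient ring R/I is represented
   by the pair (R, I): its ideals are the ideals of R containing I, and an
   equation in R/I is a congruence modulo I. *)
Section Ideals.
Variable R : comNzRingType.
Implicit Types (I J m : R -> Prop) (fs : seq R).

Definition sub_ideal I J := forall a, I a -> J a.

Definition is_ideal I :=
  [/\ I 0, forall a b, I a -> I b -> I (a + b) & forall a b, I b -> I (a * b)].

Definition ideal_gen (A : R -> Prop) : R -> Prop := fun p =>
  exists (k : nat) (a g : 'I_k -> R),
    (forall i, A (g i)) /\ p = \sum_(i < k) a i * g i.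

Definition prime_ideal I :=
  [/\ is_ideal I, ~ I 1 & forall a b, I (a * b) -> I a \/ I b].

Definition maximal_ideal m :=
  [/\ is_ideal m, ~ m 1 &
      forall J, is_ideal J -> ~ J 1 -> sub_ideal m J -> sub_ideal J m].

(* I + (f_0, ..., f_{k-1}) *)
Definition ideal_add I fs (k : nat) : R -> Prop :=
  ideal_gen (fun p => I p \/ p \in take k fs).

Definition regular_seq I fs :=
  (forall (k : nat) (g : R), (k < size fs)%N ->
     ideal_add I fs k (g * nth 0 fs k) -> ideal_add I fs k g)
  /\ ~ ideal_add I fs (size fs) 1.

(* The maximal length of a regular sequence on R/I contained in m is d. *)
Definition depth_is I m (d : nat) :=
  (exists fs, [/\ regular_seq I fs, (forall f, f \in fs -> m f) & size fs = d])
  /\ (forall fs, regular_seq I fs -> (forall f, f \in fs -> m f) ->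
        (size fs <= d)%N).

(* P 0 < P 1 < ... < P l = m is a strict chain of primes of R/I. *)
Definition prime_chain I m (l : nat) (P : nat -> R -> Prop) :=
  [/\ forall i, (i <= l)%N -> prime_ideal (P i) /\ sub_ideal I (P i),
      forall i, (i < l)%N ->
        sub_ideal (P i) (P i.+1) /\ ~ sub_ideal (P i.+1) (P i) &
      sub_ideal (P l) m /\ sub_ideal m (P l)].

(* The height of the prime m/I of R/I is d. *)
Definition height_is I m (d : nat) :=
  (exists P, prime_chain I m d P)
  /\ (forall l P, prime_chain I m l P -> (l <= d)%N).

(* R/I (a Noetherian ring in every use) is Cohen-Macaulay: depth = height at
   every maximal ideal.  By localization this is the same as requiring
   depth = dimension for the local ring at every maximal ideal. *)
Definition cohen_macaulay I :=
  forall m, maximal_ideal m -> sub_ideal I m ->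
    exists d, depth_is I m d /\ height_is I m d.

End Ideals.

Section GradedBetti.
Variables (n : nat) (F : fieldType).
Local Notation S := {mpoly F[n]}.
Implicit Types I : S -> Prop.

(* A resolution ... -> F_1 -> F_0 -> S/I -> 0 by graded free S-modules of finite
   rank, with degree-preserving maps.  F_i = \bigoplus_a S(- gen_deg i a), its
   elements are row vectors, and maps act by right multiplication. *)
Record graded_resolution I := GradedResolution {
  res_rank : nat -> nat;
  gen_deg : forall i, 'I_(res_rank i) -> nat;
  res_aug : 'cV[S]_(res_rank 0);
  res_diff : forall i, 'M[S]_(res_rank i.+1, res_rank i);
  res_aug_homog : forall a, res_aug a 0 \is (gen_deg a).-homog;
  res_diff_homog : forall i (a : 'I_(res_rank i.+1)) (b : 'I_(res_rank i)),
    (gen_deg b <= gen_deg a)%N ->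
    res_diff i a b \is (gen_deg a - gen_deg b).-homog;
  res_diff_eq0 : forall i (a : 'I_(res_rank i.+1)) (b : 'I_(res_rank i)),
    (gen_deg a < gen_deg b)%N -> res_diff i a b = 0;
  res_aug_onto : forall p : S, exists v : 'rV_(res_rank 0),
    I (p - (v *m res_aug) 0 0);
  res_exact0 : forall v : 'rV_(res_rank 0),
    I ((v *m res_aug) 0 0) <-> exists w, v = w *m res_diff 0;
  res_exactS : forall i (v : 'rV_(res_rank i.+1)),
    v *m res_diff i = 0 <-> exists w, v = w *m res_diff i.+1
}.

Section TorOfResolution.
Variables (I : S -> Prop) (C : graded_resolution I).

(* The complex C tensored over S with F = S/(variables): the constant
   coefficients of the differentials. *)
Definition tor_diff i : 'M[F]_(res_rank C i.+1, res_rank C i) :=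
  map_mx (mcoeff 0%MM) (res_diff C i).

(* Its component of internal degree j in homological degree i, as a row space *)
Definition deg_part i (j : nat) : 'M[F]_(res_rank C i) :=
  diag_mx (\row_a (gen_deg a == j)%:R).

Definition tor_cycles i (j : nat) : 'M[F]_(res_rank C i) :=
  match i return 'M[F]_(res_rank C i) with
  | 0 => deg_part 0 j
  | i'.+1 => (deg_part i'.+1 j :&: kermx (tor_diff i'))%MS
  end.

Definition tor_boundaries i (j : nat) : 'M[F]_(res_rank C i.+1, res_rank C i) :=
  deg_part i.+1 j *m tor_diff i.

(* The boundaries are a subspace of the cycles, so this is the dimension of the
   quotient. *)
Definition tor_dim i (j : nat) : nat :=
  (\rank (tor_cycles i j) - \rank (tor_boundaries i j))%N.

End TorOfResolution.

(* beta_{i,j}(S/I) = dim_F Tor_i(S/I, F)_j is equal to b.  Tor does not depend on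
   the resolution used to compute it. *)
Definition betti_is I (i j b : nat) :=
  exists C : graded_resolution I, tor_dim C i j = b.

(* t lists pairs ((i, j), beta_{i,j}) of nonzero Betti numbers; all the others
   vanish. *)
Definition betti_numbers I (t : seq (nat * nat * nat)) :=
  forall i j, betti_is I i j (\sum_(e <- t | e.1 == (i, j)) e.2)%N.

Definition generated_in_degree I (s : nat) :=
  forall p, I p <-> ideal_gen (fun q => I q /\ q \is s.-homog) p.

Definition linear_resolution_in I (s : nat) :=
  generated_in_degree I s /\
  forall i j, (1 <= i)%N -> j <> (s + i - 1)%N -> betti_is I i j 0.

Definition has_linear_resolution I :=
  exists2 s, (1 <= s)%N & linear_resolution_in I s.

End GradedBetti.

Record scomplex (V : finType) := SComplex {
  faces :> {set {set V}};
  faces_down : forall A B : {set V}, A \in faces -> B \subset A -> B \in faces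
}.

Record sgraph (V : finType) := SGraph {
  adj :> rel V;
  adj_sym : ssrbool.symmetric adj;
  adj_irr : irreflexive adj
}.

Section Complexes.
Variable V : finType.

(* The complex of all subsets of members of B *)
Definition generated_faces (B : {set {set V}}) : {set {set V}} :=
  [set A : {set V} | [exists M in B, A \subset M]].

Lemma generated_faces_down (B : {set {set V}}) (A A' : {set V}) :
  A \in generated_faces B -> A' \subset A -> A' \in generated_faces B.
Proof.
rewrite !inE => /existsP[M /andP[MB AM]] A'A; apply/existsP; exists M.
by rewrite MB (subset_trans A'A AM).
Qed.

Definition generated_complex (B : {set {set V}}) : scomplex V :=
  SComplex (@generated_faces_down B).

Definition independent (G : sgraph V) (M : {set V}) : bool :=
  [forall u in M, forall v in M, ~~ G u v].

(* The complements have the same size, so they are exactly the facets. *)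
Definition total_cut (k : nat) (G : sgraph V) : scomplex V :=
  generated_complex [set ~: M | M : {set V} & independent G M && (#|M| == k)].

Definition dual_faces (D : scomplex V) : {set {set V}} :=
  [set A : {set V} | ~: A \notin faces D].

Lemma dual_faces_down (D : scomplex V) (A B : {set V}) :
  A \in dual_faces D -> B \subset A -> B \in dual_faces D.
Proof.
rewrite !inE => AD BA; apply: contra AD => BD.
by apply: (faces_down BD); rewrite setCS.
Qed.

Definition alexander_dual (D : scomplex V) : scomplex V :=
  SComplex (@dual_faces_down D).

Definition xvar (F : fieldType) (v : V) : {mpoly F[#|V|]} := 'X_(enum_rank v).

(* I_Delta, so that (S, I_Delta) represents the Stanley-Reisner ring *)
Definition sr_ideal (F : fieldType) (D : scomplex V) : {mpoly F[#|V|]} -> Prop :=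
  ideal_gen (fun p =>
    exists2 A : {set V}, A \notin faces D & p = \prod_(v in A) xvar F v).

End Complexes.

Arguments xvar {V} F v.
Arguments sr_ideal {V} F D _.

(* K_2 x K_n: x_i is (false, i) and y_i is (true, i). *)
Definition K2K_adj (n : nat) : rel (bool * 'I_n) := fun u v =>
  ((u.1 == v.1) && (u.2 != v.2)) || ((u.1 != v.1) && (u.2 == v.2)).

Lemma K2K_sym n : ssrbool.symmetric (@K2K_adj n).
Proof. by move=> u v; rewrite /K2K_adj ![v.1 == _]eq_sym ![v.2 == _]eq_sym. Qed.

Lemma K2K_irr n : irreflexive (@K2K_adj n).
Proof. by move=> u; rewrite /K2K_adj !eqxx. Qed.

Definition K2K (n : nat) : sgraph (bool * 'I_n)%type :=
  SGraph (@K2K_sym n) (@K2K_irr n).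

(* Main.v *)
Require Import Defs.
From HB Require Import structures.
From mathcomp Require Import all_boot all_order all_algebra.
From mathcomp.multinomials Require Import mpoly.
From mathcomp Require Import ring zify.
Set Implicit Arguments.
Unset Strict Implicit.
Unset Printing Implicit Defensive.
Import GRing.Theory.
Local Open Scope ring_scope.

(** Depth is measured by Koszul cohomology: a regular sequence of length [d]
    contained in the ideal [(x)] makes [H^i(x; M)] vanish for [i < d], and this
    passes to [M / g M] with one [i] less for any [M]-regular [g].  If the link of a
    face [Z] is disconnected, take for [x] the generators of the maximal ideal of
    the point with coordinates 1 on [Z] and 0 elsewhere: modulo the regular
    sequence [x_z - 1], [z] in [Z], the idempotent of one part of the link gives a
    nonzero class in [H^1], so the depth at that point is at most [#|Z| + 1], while
    any larger face through [Z] bounds the height from below.  For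
    [n > 2] both complexes have such a face [Z]: the complement of an induced
    4-cycle for the total cut complex, a single vertex for its dual, which is the
    clique complex of the graph.

    For [n > 2] the total cut complex has minimal nonfaces of the different sizes
    [n] and [2n - 2].  The clique complex has an induced 4-cycle, so the Koszul
    relation between its two diagonals is a minimal syzygy of degree 4 and
    [beta_(2,4) <> 0].  For [n = 2] the resolutions are written down. *)

(** * Koszul cohomology and depth *)

Section IdealTheory.
Variable R : comNzRingType.
Implicit Types (I J : R -> Prop) (A : R -> Prop).

Lemma is_ideal0 J : is_ideal J -> J 0. Proof. by case. Qed.

Lemma is_idealD J a b : is_ideal J -> J a -> J b -> J (a + b).
Proof. by case=> _ HD _; apply: HD. Qed.

Lemma is_idealMl J a b : is_ideal J -> J b -> J (a * b).
Proof. by case=> _ _; apply. Qed.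

Lemma is_idealMr J a b : is_ideal J -> J a -> J (a * b).
Proof. by rewrite mulrC; apply: is_idealMl. Qed.

Lemma is_idealN J a : is_ideal J -> J a -> J (- a).
Proof. by rewrite -mulN1r; apply: is_idealMl. Qed.

Lemma is_idealB J a b : is_ideal J -> J a -> J b -> J (a - b).
Proof. by move=> HJ Ja Jb; apply: is_idealD => //; apply: is_idealN. Qed.

Lemma is_ideal_sum J (T : Type) (r : seq T) (P : pred T) (f : T -> R) :
  is_ideal J -> (forall i, P i -> J (f i)) -> J (\sum_(i <- r | P i) f i).
Proof.
move=> HJ Hf; elim/big_rec: _ => [|i x Pi Jx]; first exact: is_ideal0.
by apply: is_idealD => //; apply: Hf.
Qed.

Lemma ideal_gen_is_ideal A : is_ideal (ideal_gen A).
Proof.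
split.
- exists 0, (fun=> 0), (fun=> 0); split; first by case.
  by rewrite big_ord0.
- move=> p q [k1 [a1 [g1 [A1 ->]]]] [k2 [a2 [g2 [A2 ->]]]].
  exists (k1 + k2)%N.
  exists (fun i => match split i with inl j => a1 j | inr j => a2 j end).
  exists (fun i => match split i with inl j => g1 j | inr j => g2 j end).
  split; first by move=> i; case: (split i).
  rewrite big_split_ord /=; congr (_ + _); apply: eq_bigr => i _.
    by rewrite (unsplitK (inl i)).
  by rewrite (unsplitK (inr i)).
- move=> c p [k [a [g [Ag ->]]]]; exists k, (fun i => c * a i), g; split=> //.
  by rewrite mulr_sumr; apply: eq_bigr => i _; rewrite mulrA.
Qed.

Lemma ideal_gen_mem A p : A p -> ideal_gen A p.
Proof.
by move=> Ap; exists 1%N, (fun=> 1), (fun=> p); rewrite big_ord1 mul1r.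
Qed.

Lemma ideal_gen_min A J : is_ideal J -> (forall p, A p -> J p) ->
  sub_ideal (ideal_gen A) J.
Proof.
move=> HJ AJ p [k [a [g [Ag ->]]]]; apply: is_ideal_sum => // i _.
by apply: is_idealMl => //; apply: AJ.
Qed.

Lemma ideal_add_is_ideal I fs k : is_ideal (ideal_add I fs k).
Proof. exact: ideal_gen_is_ideal. Qed.

Lemma ideal_add0 I fs : is_ideal I -> sub_ideal (ideal_add I fs 0) I.
Proof. by move=> HI; apply: ideal_gen_min => // p; rewrite take0; case. Qed.

Lemma ideal_addS I fs k p : (k < size fs)%N -> ideal_add I fs k.+1 p ->
  exists q, ideal_add I fs k (p - nth 0 fs k * q).
Proof.
move=> lt_k; have Hk := ideal_add_is_ideal I fs k.
pose J p := exists q, ideal_add I fs k (p - nth 0 fs k * q).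
have HJ : is_ideal J.
  split.
  - by exists 0; rewrite mulr0 subr0; apply: is_ideal0.
  - move=> a b [q1 J1] [q2 J2]; exists (q1 + q2).
    by rewrite mulrDr opprD addrACA; apply: is_idealD.
  - move=> a b [q J1]; exists (a * q).
    by rewrite mulrCA -mulrBr; apply: is_idealMl.
apply: (ideal_gen_min HJ) => {}p; rewrite (take_nth 0) // mem_rcons in_cons.
case=> [Ip|/orP[/eqP->|p_fs]].
- by exists 0; rewrite mulr0 subr0; apply: ideal_gen_mem; left.
- by exists 1; rewrite mulr1 subrr; apply: is_ideal0.
- by exists 0; rewrite mulr0 subr0; apply: ideal_gen_mem; right.
Qed.

Lemma ideal_add_sub I fs k :
  (k < size fs)%N -> sub_ideal (ideal_add I fs k) (ideal_add I fs k.+1).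
Proof.
move=> lt_k; apply: ideal_gen_min => [|p]; first exact: ideal_add_is_ideal.
case=> [Ip|p_fs]; apply: ideal_gen_mem; first by left.
by right; rewrite (take_nth 0) // mem_rcons in_cons p_fs orbT.
Qed.

Lemma ideal_add_nth I fs k :
  (k < size fs)%N -> ideal_add I fs k.+1 (nth 0 fs k).
Proof.
move=> lt_k; apply: ideal_gen_mem; right.
by rewrite (take_nth 0) // mem_rcons mem_head.
Qed.

End IdealTheory.

Section Koszul.
Variables (R : comNzRingType) (T : finType) (x : T -> R).
Implicit Types (J : R -> Prop) (a b : seq T -> R) (t : seq T).

(** The Koszul differential: unfolded, the alternating sum over the positions of [t] of [x l] times
    the value of [a] at [t] with that letter [l] deleted. *)
Fixpoint kd a t : R :=
  if t is l :: t' then x l * a t' - kd (fun s => a (l :: s)) t' else 0.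

Lemma eq_kd a b t : (forall s, size s = (size t).-1 -> a s = b s) ->
  kd a t = kd b t.
Proof.
elim: t a b => [|l t IH] a b //= eq_ab; rewrite eq_ab //.
congr (_ - _); case: t => [|l' t] // in IH eq_ab *.
by apply: IH => s sz_s; apply: eq_ab; rewrite /= sz_s.
Qed.

Lemma kdB a b t : kd (fun s => a s - b s) t = kd a t - kd b t.
Proof.
by elim: t a b => [|l t IH] a b /=; rewrite ?subrr // IH; ring.
Qed.

Lemma kdD a b t : kd (fun s => a s + b s) t = kd a t + kd b t.
Proof.
by elim: t a b => [|l t IH] a b /=; rewrite ?addr0 // IH; ring.
Qed.

Lemma kdZ c a t : kd (fun s => c * a s) t = c * kd a t.
Proof. by elim: t a => [|l t IH] a /=; rewrite ?mulr0 // IH; ring. Qed.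

Lemma kd0 t : kd (fun=> 0) t = 0.
Proof. by elim: t => //= l t ->; rewrite mulr0 subrr. Qed.

Lemma kd_sum (S : Type) (r : seq S) (a : S -> seq T -> R) t :
  kd (fun s => \sum_(i <- r) a i s) t = \sum_(i <- r) kd (a i) t.
Proof.
elim: r => [|i r IH].
  by rewrite big_nil -[RHS](kd0 t); apply: eq_kd => s _; rewrite big_nil.
by rewrite big_cons -IH -kdD; apply: eq_kd => s _; rewrite big_cons.
Qed.

Lemma kd_ideal J i a : is_ideal J -> (forall s, size s = i -> J (a s)) ->
  forall t, size t = i.+1 -> J (kd a t).
Proof.
move=> HJ; elim: i a => [|i IH] a Ja [|l t] //= [sz_t].
  rewrite (size0nil sz_t) /= subr0; apply: is_idealMl => //; exact: Ja.
apply: is_idealB => //; first by apply: is_idealMl => //; apply: Ja.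
by apply: IH => // s sz_s; apply: Ja; rewrite /= sz_s.
Qed.

Lemma kdK a t : kd (kd a) t = 0.
Proof.
elim: t a => //= l t IH a.
by rewrite (kdB (fun s => x l * a s)) kdZ IH; ring.
Qed.

(* The cochains are neither alternating nor supported on distinct indices, so
   this is the cohomology of a complex much larger than the Koszul complex.  It
   is still annihilated by the [x l], which is all that is needed to measure
   depth, and no signs of permutations appear. *)
Definition koszul_vanishes J i :=
  forall a, (forall t, size t = i.+1 -> J (kd a t)) ->
    exists b, forall t, size t = i -> J (a t - kd b t).

(** Contraction with [h] is a homotopy from multiplication by the sum of the [h l * x l] to zero, so
    the ideal of the [x l] kills cohomology. *)
Lemma kd_homotopy (h : T -> R) a t :
  kd (fun s => \sum_l h l * a (l :: s)) t =
    (\sum_l h l * x l) * a t - \sum_l h l * kd a (l :: t).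
Proof.
rewrite (kd_sum _ (fun l s => h l * a (l :: s))) mulr_suml -sumrB.
by apply: eq_bigr => l _; rewrite kdZ /=; ring.
Qed.

Section Step.
Variables (J J' : R -> Prop) (f : R).
Hypotheses (HJ : is_ideal J) (HJ' : is_ideal J').
Hypotheses (JJ' : sub_ideal J J') (J'f : J' f).
Hypothesis J'P : forall p, J' p -> exists q, J (p - f * q).
Hypothesis regf : forall p, J (f * p) -> J p.

(** A cocycle of degree 0 is one element killed modulo [J] by every [x l], hence by [f], which is
    regular modulo [J]. *)
Lemma koszul_vanishes0 (h : T -> R) :
  f = \sum_l h l * x l -> koszul_vanishes J 0.
Proof.
(* Any cochain would do as witness, since [kd] is 0 on the empty word. *)
move=> def_f a da; exists a => -[|//] _ /=; rewrite subr0; apply: regf.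
rewrite def_f mulr_suml; apply: is_ideal_sum => // l _; rewrite -mulrA.
by apply: is_idealMl => //; have := da [:: l] erefl; rewrite /= subr0.
Qed.

(** Choice is finite here: words of length [i] are tuples over a finite type. The cochain is set to
    0 on all other words. *)
Lemma choose_cochain i (P : seq T -> R -> Prop) :
  (forall t, size t = i -> exists u, P t u) ->
  exists g, forall t, size t = i -> P t (g t).
Proof.
move=> exP.
have [w wP] : exists w : i.-tuple T -> R, forall t : i.-tuple T, P t (w t).
  by apply: (@fin_all_exists _ _ (fun t : i.-tuple T => P t)) => t; apply: exP; rewrite size_tuple.
exists (fun t => if insub t is Some t' then w t' else 0) => t sz_t.
by case: insubP => [t' _ <-|/eqP//]; apply: wP.
Qed.

(** Modulo [J], the contraction [c] of a cocycle [a] satisfies [kd c = f a], so [c] is a cocycle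
    modulo [J'] and equals some [kd e] there. Writing [c = kd e + f g] modulo [J] gives
    [f a = f kd g], and [f] cancels. *)
Lemma koszul_vanishesS (h : T -> R) i :
  f = \sum_l h l * x l -> koszul_vanishes J' i -> koszul_vanishes J i.+1.
Proof.
move=> def_f Vi a da; pose c s := \sum_l h l * a (l :: s).
have dc t : size t = i.+1 -> J (f * a t - kd c t).
  move=> sz_t; rewrite kd_homotopy -def_f opprB addrCA subrr addr0.
  by apply: is_ideal_sum => // l _; apply: is_idealMl => //; apply: da; rewrite /= sz_t.
have [t sz_t|e eP] := Vi c.
  have -> : kd c t = f * a t - (f * a t - kd c t) by ring.
  by apply: is_idealB => //; [apply: is_idealMr|apply/JJ'/dc].
have [g gP] := choose_cochain (fun t sz_t => J'P (eP t sz_t)).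
exists g => t sz_t; apply: regf; rewrite mulrBr -kdZ.
have : J (kd (fun s => c s - kd e s - f * g s) t) by apply: (kd_ideal HJ gP).
rewrite kdB (kdB c) kdK subr0 => Jd.
have -> : f * a t - kd (fun s => f * g s) t =
   (f * a t - kd c t) + (kd c t - kd (fun s => f * g s) t) by ring.
by apply: is_idealD => //; apply: dc.
Qed.

(** Part of the long exact sequence of [0 -> R/J -> R/J -> R/J' -> 0], the first map being
    multiplication by [f]. If [kd a = f c] modulo [J], then [c] is a cocycle, so [c = kd e], and
    [a - f e] is a cocycle modulo [J], hence a coboundary. *)
Lemma koszul_vanishes_quotient i :
  koszul_vanishes J i -> koszul_vanishes J i.+1 -> koszul_vanishes J' i.
Proof.
move=> Vi Vi1 a da.
have [c cP] := choose_cochain (fun t sz_t => J'P (da t sz_t)).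
have [t sz_t|e eP] := Vi1 c.
  apply: regf; rewrite -kdZ -[X in J X]opprK; apply: is_idealN => //.
  rewrite -[X in J X]add0r -(kdK a t) -kdB; exact: (kd_ideal HJ cP).
have [t sz_t|b bP] := Vi (fun t => a t - f * e t).
  rewrite kdB kdZ.
  have -> : kd a t - f * kd e t = (kd a t - f * c t) + f * (c t - kd e t) by ring.
  by apply: is_idealD (cP _ sz_t) _ => //; apply: is_idealMl => //; apply: eP.
exists b => t sz_t.
have -> : a t - kd b t = (a t - f * e t - kd b t) + f * e t by ring.
by apply: is_idealD => //; [apply/JJ'/bP|apply: is_idealMr].
Qed.

End Step.

Lemma regular_seq_koszul_vanishes I fs :
  is_ideal I -> regular_seq I fs ->
  (forall f, f \in fs -> exists h : T -> R, f = \sum_l h l * x l) ->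
  forall i, (i < size fs)%N -> koszul_vanishes I i.
Proof.
move=> HI [reg _] fs_x.
(* Induction on [i] for all [k] at once: degree [i.+1] over the first [k] elements comes from degree
   [i] over the first [k.+1]. *)
suff H i k : (i + k < size fs)%N -> koszul_vanishes (ideal_add I fs k) i.
  move=> i lt_i a da; have [|t sz_t|b bP] := H i 0 _ a.
  - by rewrite addn0.
  - by apply: ideal_gen_mem; left; apply: da.
  - by exists b => t sz_t; apply: ideal_add0 HI _ (bP _ sz_t).
have HA k' := ideal_add_is_ideal I fs k'.
elim: i k => [|i IH] k lt_k.
  have [h def_f] := fs_x _ (mem_nth 0 lt_k).
  apply: (koszul_vanishes0 (HA k) _ def_f) => p; rewrite mulrC; exact: reg.
have lt_k' : (k < size fs)%N by apply: leq_ltn_trans lt_k; rewrite leq_addl.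
have [h def_f] := fs_x _ (mem_nth 0 lt_k').
apply: (koszul_vanishesS (HA k) (HA k.+1) _ _ _ _ def_f).
- exact: ideal_add_sub.
- exact: ideal_add_nth.
- by move=> p; apply: ideal_addS.
- by move=> p; rewrite mulrC; apply: reg.
- by apply: IH; rewrite addnS.
Qed.

End Koszul.

(** * Stanley-Reisner rings and disconnected links *)

Lemma subrMM (R : comNzRingType) (a b c d : R) :
  a * b - c * d = (a - c) * b + c * (b - d).
Proof. by ring. Qed.

Lemma mul1_sub_cancel (R : comNzRingType) (a p q : R) :
  q * (a - 1) + p - (a - 1) * (q - p) = a * p.
Proof. by ring. Qed.

(** * Substitutions and the ideals of points and linear spaces *)

Section Substitution.
Variables (F : fieldType) (V : finType).
Local Notation S := {mpoly F[#|V|]}.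
Local Notation X := (xvar F).
Implicit Types (h : V -> S) (p q : S).

Definition msubst h : S -> S :=
  mmap (@mpolyC #|V| F) (fun i => h (enum_val i)).

HB.instance Definition _ h := GRing.RMorphism.on (msubst h).

Lemma msubst_var h v : msubst h (X v) = h v.
Proof. by rewrite /msubst mmapX mmap1U enum_rankK. Qed.

Lemma msubst_varB h v k : msubst h (X v - k%:R) = h v - k%:R.
Proof. by rewrite rmorphB /= msubst_var rmorph_nat. Qed.

Lemma msubstC h c : msubst h c%:MP = c%:MP.
Proof. by rewrite /msubst mmapC. Qed.

Lemma mpoly_ring_ind (P : S -> Prop) :
  (forall c, P c%:MP) -> (forall v, P (X v)) ->
  (forall p q, P p -> P q -> P (p + q)) ->
  (forall p q, P p -> P q -> P (p * q)) -> forall p, P p.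
Proof.
move=> PC PX PD PM; elim/mpolyind=> [|c m p _ _ Pp]; first by rewrite -mpolyC0.
apply: PD => //; rewrite -mul_mpolyC mpolyXE_id; apply: (PM) => //.
elim/big_rec: _ => [|i q _ Pq]; first by rewrite -mpolyC1.
apply: (PM) => //; elim: (m i) => [|k IH]; first by rewrite expr0 -mpolyC1.
by rewrite exprS; apply: PM => //; rewrite -[i]enum_valK; apply: PX.
Qed.

Lemma eq_msubst h h' : h =1 h' -> msubst h =1 msubst h'.
Proof.
move=> eq_h p; elim/mpoly_ring_ind: p => [c|v|p q IHp IHq|p q IHp IHq].
- by rewrite !msubstC.
- by rewrite !msubst_var.
- by rewrite !rmorphD /= IHp IHq.
- by rewrite !rmorphM /= IHp IHq.
Qed.

Lemma msubst_id p : msubst X p = p.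
Proof.
elim/mpoly_ring_ind: p => [c|v|p q IHp IHq|p q IHp IHq].
- by rewrite !msubstC.
- by rewrite !msubst_var.
- by rewrite !rmorphD /= IHp IHq.
- by rewrite !rmorphM /= IHp IHq.
Qed.

Lemma msubst_comp h h' p : msubst h (msubst h' p) = msubst (msubst h \o h') p.
Proof.
elim/mpoly_ring_ind: p => [c|v|p q IHp IHq|p q IHp IHq].
- by rewrite !msubstC.
- by rewrite !msubst_var.
- by rewrite !rmorphD /= IHp IHq.
- by rewrite !rmorphM /= IHp IHq.
Qed.

(** Both substitutions agree modulo the ideal of the [h v - h' v]: this is clear on variables, and
    products are handled by the telescoping identity [subrMM]. *)
Lemma msubstB h h' p :
  exists q : V -> S, msubst h p - msubst h' p = \sum_v q v * (h v - h' v).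
Proof.
elim/mpoly_ring_ind: p => [c|v|p1 p2 [q1 E1] [q2 E2]|p1 p2 [q1 E1] [q2 E2]].
- exists (fun=> 0); rewrite !msubstC subrr big1 // => v _; exact: mul0r.
- exists (fun w => (w == v)%:R); rewrite (bigD1 v) //= big1 => [|w /negPf->].
    by rewrite eqxx mul1r addr0 !msubst_var.
  exact: mul0r.
- exists (fun v => q1 v + q2 v); rewrite !rmorphD /= opprD addrACA E1 E2.
  by rewrite -big_split; apply: eq_bigr => v _; rewrite mulrDl.
- exists (fun v => q1 v * msubst h p2 + msubst h' p1 * q2 v).
  rewrite !rmorphM /= subrMM E1 E2 mulr_suml mulr_sumr -big_split.
  by apply: eq_bigr => v _ /=; rewrite mulrDl mulrAC; congr (_ + _); rewrite mulrA.
Qed.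

(** Turns vanishing under a substitution into membership in the ideal of the [X v - h v]. *)
Lemma subr_msubst h p :
  exists q : V -> S, p - msubst h p = \sum_v q v * (X v - h v).
Proof. by rewrite -{1}[p]msubst_id; apply: msubstB. Qed.

Lemma msubst_const h p : (forall v, exists c, h v = c%:MP) ->
  exists c, msubst h p = c%:MP.
Proof.
move=> hC; elim/mpoly_ring_ind: p => [c|v|p q [c E] [d E']|p q [c E] [d E']].
- by exists c; apply: msubstC.
- by rewrite msubst_var.
- by exists (c + d); rewrite rmorphD /= E E' mpolyCD.
- by exists (c * d); rewrite rmorphM /= E E' mpolyCM.
Qed.

Lemma xvar_neqC (v : V) c : X v != c%:MP.
Proof.
apply/eqP=> /mpolyP/(_ U_(enum_rank v)%MM).
by rewrite mcoeffX mcoeffC eqxx mnm1_eq0 mulr0 => /eqP; rewrite oner_eq0.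
Qed.

Lemma xvar_eq0 (v : V) : (X v == 0) = false.
Proof. by rewrite -mpolyC0 (negPf (xvar_neqC _ _)). Qed.

Definition msubst_ker h p := msubst h p = 0.

Lemma msubst_ker_ideal h : is_ideal (msubst_ker h).
Proof.
split=> [|a b|a b]; rewrite /msubst_ker ?rmorph0 // ?rmorphD ?rmorphM /=.
  by move=> -> ->; rewrite addr0.
by move=> ->; rewrite mulr0.
Qed.

Lemma msubst_ker_prime h : prime_ideal (msubst_ker h).
Proof.
split=> [||a b]; first exact: msubst_ker_ideal.
  by apply/eqP; rewrite rmorph1 oner_eq0.
by rewrite /msubst_ker rmorphM /= => /eqP; rewrite mulf_eq0 => /orP[]/eqP; auto.
Qed.

Lemma msubst_ker_maximal h : (forall v, exists c, h v = c%:MP) ->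
  maximal_ideal (msubst_ker h).
Proof.
move=> hC; have [HI H1 _] := msubst_ker_prime h; split=> // J HJ J1 mJ p Jp.
have [c pc] := msubst_const p hC.
have [c0|c0] := eqVneq c 0; first by rewrite /msubst_ker pc c0 mpolyC0.
case: J1; have Jc : J c%:MP.
  rewrite -pc -[msubst h p](subKr p); apply: is_idealB => //; apply: mJ.
  rewrite /msubst_ker rmorphB /= msubst_comp.
  apply/eqP; rewrite subr_eq0; apply/eqP/eq_msubst=> v /=.
  by have [d ->] := hC v; rewrite msubstC.
have -> : 1 = (c^-1)%:MP * c%:MP :> S by rewrite -mpolyCM mulVf // mpolyC1.
exact: is_idealMl.
Qed.

End Substitution.

Section StanleyReisner.
Variables (F : fieldType) (V : finType) (D : scomplex V).
Local Notation S := {mpoly F[#|V|]}.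
Local Notation X := (xvar F).
Implicit Types (p q : S) (A C Z U : {set V}) (m : 'X_{1..#|V|}).

Definition mvars m : {set V} := [set v | m (enum_rank v) != 0].

Definition mset A : 'X_{1..#|V|} := [multinom (enum_val i \in A : nat) | i < #|V|].

Lemma msetE A v : mset A (enum_rank v) = (v \in A).
Proof. by rewrite mnmE enum_rankK. Qed.

Lemma mvars_mset A : mvars (mset A) = A.
Proof. by apply/setP=> v; rewrite inE msetE; case: (v \in A). Qed.

Lemma prod_xvar A : \prod_(v in A) X v = 'X_[mset A].
Proof.
rewrite mprodXE; congr 'X_[_]; apply/mnmP=> i; rewrite mnm_sumE mnmE.
rewrite -[i]enum_valK enum_rankK; move: (enum_val i) => v.
case: (boolP (v \in A)) => Av.
  rewrite (bigD1 v) //= big1 ?addn0 ?mnm1E ?eqxx // => w /andP[_ wv].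
  by rewrite mnm1E (inj_eq enum_rank_inj) (negPf wv).
apply: big1 => w Aw; rewrite mnm1E (inj_eq enum_rank_inj).
by case: eqVneq => // E; rewrite -E Aw in Av.
Qed.

Lemma mset_le A m : (mset A <= m)%MM = (A \subset mvars m).
Proof.
apply/mnm_lepP/subsetP=> [H v Av|H i].
  by have := H (enum_rank v); rewrite msetE Av inE lt0n.
rewrite -[i]enum_valK msetE; case: (boolP (_ \in A)) => // /H.
by rewrite inE lt0n.
Qed.

Lemma mvars_le m1 m2 : (m1 <= m2)%MM -> mvars m1 \subset mvars m2.
Proof.
move/mnm_lepP=> H; apply/subsetP=> v; rewrite !inE -!lt0n => lt0.
exact: leq_trans (H _).
Qed.

Lemma sr_ideal_is_ideal : is_ideal (sr_ideal F D).
Proof. exact: ideal_gen_is_ideal. Qed.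

Lemma sr_idealX m : mvars m \notin faces D -> sr_ideal F D 'X_[m].
Proof.
move=> mD; have le_m : (mset (mvars m) <= m)%MM by rewrite mset_le.
rewrite -(submK le_m) mpolyXD; apply: is_idealMl; first exact: sr_ideal_is_ideal.
by apply: ideal_gen_mem; exists (mvars m); rewrite ?prod_xvar.
Qed.

(* This is the ideal generated by the Stanley-Reisner ideal and all [x_z - 1],
   [z] in [Z], given as an intersection of primes: each one says that
   [p] vanishes on a linear space. *)
Definition face_subst Z C v : S :=
  if v \in Z then 1 else if v \in C then X v else 0.

Definition link_ideal Z p :=
  forall C, C \in faces D -> Z \subset C -> msubst (face_subst Z C) p = 0.

Lemma link_ideal_is_ideal Z : is_ideal (link_ideal Z).
Proof.
split=> [|a b Ja Jb|a b Jb] C CD ZC; have [H0 HD HM] :=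
  msubst_ker_ideal (face_subst Z C).
- exact: H0.
- by apply: HD; [apply: Ja|apply: Jb].
- by apply: HM; apply: Jb.
Qed.

Lemma sr_ideal_sub_link : sub_ideal (sr_ideal F D) (link_ideal set0).
Proof.
apply: ideal_gen_min => [|p [A AD ->] C CD _]; first exact: link_ideal_is_ideal.
have [v Av vC] : exists2 v, v \in A & v \notin C.
  by apply/subsetPn; apply: contra AD; apply: faces_down.
rewrite rmorph_prod (bigD1 v) //= msubst_var /face_subst inE (negPf vC).
exact: mul0r.
Qed.

Lemma msubst_faceX C m :
  msubst (face_subst set0 C) 'X_[m] = if mvars m \subset C then 'X_[m] else 0.
Proof.
case: ifPn => [/subsetP mC|/subsetPn[v]].
  rewrite mpolyXE_id rmorph_prod; apply: eq_bigr => i _.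
  rewrite -[i]enum_valK rmorphXn /= msubst_var /face_subst inE.
  case: ifPn => // iC; suff -> : m (enum_rank (enum_val i)) = 0%N by rewrite !expr0.
  by apply/eqP; apply: contraNT iC => mi; apply: mC; rewrite inE.
rewrite inE => mv vC; rewrite mpolyXE_id rmorph_prod (bigD1 (enum_rank v)) //=.
rewrite rmorphXn /= msubst_var /face_subst inE (negPf vC) expr0n (negPf mv).
exact: mul0r.
Qed.

(** If the support of [m] were a face, setting the other variables to 0 would keep the coefficient
    of [m] in [p], although [p] is sent to 0. *)
Lemma link_ideal0_mvars p m :
  link_ideal set0 p -> m \in msupp p -> mvars m \notin faces D.
Proof.
move=> Jp mp; apply/negP => mD.
have /mpolyP/(_ m) := Jp _ mD (sub0set _).
rewrite {1}[p]mpolyE rmorph_sum raddf_sum mcoeff0 /= (bigD1_seq m) ?msupp_uniq //=.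
rewrite -mul_mpolyC rmorphM /= msubstC msubst_faceX subxx mcoeffCM mcoeffX eqxx.
rewrite mulr1 big1 ?addr0 => [/eqP|m' m'm]; first by rewrite mcoeff_eq0 mp.
rewrite -mul_mpolyC rmorphM /= msubstC msubst_faceX mcoeffCM.
by case: ifP => _; rewrite ?mcoeff0 ?mcoeffX ?(negPf m'm) mulr0.
Qed.

(** With the converse inclusion, this presents the Stanley-Reisner ideal as the intersection of the
    primes of the faces. *)
Lemma link_ideal0_sub_sr : sub_ideal (link_ideal set0) (sr_ideal F D).
Proof.
move=> p Jp; rewrite [p]mpolyE big_seq; apply: is_ideal_sum => [|m mp].
  exact: sr_ideal_is_ideal.
rewrite -mul_mpolyC; apply: is_idealMl; first exact: sr_ideal_is_ideal.
exact/sr_idealX/(link_ideal0_mvars Jp).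
Qed.

Lemma sr_ideal_mvars p m :
  sr_ideal F D p -> m \in msupp p -> mvars m \notin faces D.
Proof. by move/sr_ideal_sub_link; apply: link_ideal0_mvars. Qed.

Definition link_point Z v : S := (v \in Z)%:R.

Definition subst1 z v : S := if v == z then 1 else X v.

Lemma msubst_face_subst1 Z C z p : z \in C ->
  msubst (face_subst Z C) (msubst (subst1 z) p) = msubst (face_subst (z |: Z) C) p.
Proof.
move=> zC; rewrite msubst_comp; apply: eq_msubst => v /=.
rewrite /subst1 /face_subst !inE.
by case: eqVneq => [->|_] /=; rewrite ?rmorph1 ?msubst_var.
Qed.

Lemma msubst_subst1_face Z C z p : z \in C ->
  msubst (subst1 z) (msubst (face_subst Z C) p) = msubst (face_subst (z |: Z) C) p.
Proof.
move=> zC; rewrite msubst_comp; apply: eq_msubst => v /=.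
rewrite /subst1 /face_subst !inE.
case: ifP => [|_]; first by rewrite rmorph1 orbT.
rewrite orbF; case: ifP => [_|vC]; first by rewrite msubst_var.
by rewrite rmorph0; case: eqVneq => // E; rewrite E zC in vC.
Qed.

Section KoszulLink.
Variable x : V -> S.

(* A polynomial [p] with [p(x_z := 1)] in the ideal of [z |: Z] is congruent modulo
   [x_z - 1] to [x_z * p(x_z := 1)], which lies in the ideal of [Z]. *)
Lemma koszul_vanishes_link_setU1 Z z i : z \notin Z ->
  koszul_vanishes x (link_ideal Z) i -> koszul_vanishes x (link_ideal Z) i.+1 ->
  koszul_vanishes x (link_ideal (z |: Z)) i.
Proof.
move=> zZ; apply: (@koszul_vanishes_quotient _ _ _ _ _ (X z - 1));
  try exact: link_ideal_is_ideal.
- move=> p Jp C CD; rewrite subUset sub1set => /andP[zC ZC].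
  by rewrite -msubst_subst1_face // Jp ?rmorph0.
- move=> C _ _; rewrite rmorphB rmorph1 /= msubst_var /face_subst setU11.
  by rewrite subrr.
- move=> p Jp; have [q] := subr_msubst (subst1 z) p.
  set p1 := msubst _ p; rewrite (bigD1 z) //= /subst1 eqxx big1 => [|v /negPf->].
    rewrite addr0 => Ep; exists (q z - p1).
    have -> : p - (X z - 1) * (q z - p1) = X z * p1.
      have -> : p = q z * (X z - 1) + p1 by rewrite -Ep subrK.
      exact: mul1_sub_cancel.
    move=> C CD ZC; rewrite rmorphM /= msubst_var /face_subst (negPf zZ).
    case: ifP => zC; last by rewrite mul0r.
    rewrite [X in _ * X](msubst_face_subst1 _ _ zC) Jp ?mulr0 //.
    by rewrite subUset sub1set zC.
  by rewrite subrr mulr0.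
(* Regularity of [X z - 1]: each substitution sends it to [X z - 1] or to -1, which is nonzero in a
   domain. *)
- move=> p Jp C CD ZC; have /eqP := Jp C CD ZC; rewrite rmorphM mulf_eq0 /=.
  case/orP=> /eqP // /eqP; rewrite rmorphB rmorph1 /= msubst_var /face_subst.
  rewrite (negPf zZ) subr_eq0 -mpolyC1; case: ifP => _; last first.
    by rewrite mpolyC1 eq_sym oner_eq0.
  by rewrite (negPf (xvar_neqC _ _)).
Qed.

(** Each vertex of [Z] means one more quotient by some [x_z - 1], which costs one degree of
    vanishing. *)
Lemma koszul_vanishes_link Z d :
  (forall i, (i < d)%N -> koszul_vanishes x (sr_ideal F D) i) ->
  forall i, (i + #|Z| < d)%N -> koszul_vanishes x (link_ideal Z) i.
Proof.
move=> Vd; elim: {Z}#|Z| {-2}Z (erefl #|Z|) => [|k IH] Z card_Z i lt_i.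
  rewrite (cards0_eq card_Z) => a da; have [||b bP] := Vd i _ a.
  - by move: lt_i; rewrite card_Z addn0.
  - by move=> t sz_t; apply/link_ideal0_sub_sr/da.
  - by exists b => t sz_t; apply/sr_ideal_sub_link/bP.
have /card_gt0P[z zZ] : (0 < #|Z|)%N by rewrite card_Z.
have card_Zz : #|Z :\ z| = k by move: card_Z; rewrite (cardsD1 z) zZ => -[].
rewrite -(setD1K zZ); apply: koszul_vanishes_link_setU1; rewrite ?setD11 //.
  by apply: IH => //; apply: ltn_trans lt_i; rewrite card_Z card_Zz addnS.
by apply: IH => //; rewrite card_Zz addSnnS -card_Z.
Qed.

End KoszulLink.

Lemma link_point_const Z v : exists c, link_point Z v = c%:MP.
Proof. by exists (v \in Z)%:R; rewrite mpolyC_nat. Qed.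

(* The cocycle is the idempotent of [U], which is regular on the punctured
   spectrum of the disconnected link but not at the origin. *)
Lemma koszul_nonvanishing Z U C1 C2 :
  (forall C, C \in faces D -> Z \subset C -> (C \subset Z :|: U) || [disjoint C & U]) ->
  C1 \in faces D -> C2 \in faces D -> Z \proper C1 -> Z \proper C2 ->
  C1 \subset Z :|: U -> [disjoint C2 & U] -> [disjoint Z & U] ->
  ~ koszul_vanishes (fun v => X v - link_point Z v) (link_ideal Z) 1.
Proof.
move=> sep C1D C2D ZC1 ZC2 C1U C2U ZU van.
set t := fun v => _ in van; pose u v := if v \in U then X v else 0.
(* On the linear space of each face, [u] is [t] times a constant, 1 or 0; hence [u] is a cocycle of
   degree 1. *)
have Eu C v : C \in faces D -> Z \subset C ->
    msubst (face_subst Z C) (u v) =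
    msubst (face_subst Z C) (t v) * (C \subset Z :|: U)%:R.
  move=> CD ZC; rewrite /t /u msubst_varB /face_subst.
  have uZ : v \in U -> v \notin Z by move=> vU; rewrite (disjointFl ZU).
  case: ifP => [vU|vU]; rewrite ?rmorph0 ?msubst_var.
    rewrite /face_subst (negPf (uZ vU)) subr0.
    case: ifP => vC; rewrite ?mul0r //.
    have := sep C CD ZC; case: (C \subset _) => [_|]; first by rewrite mulr1.
    by move/disjointFr => /(_ _ vC); rewrite vU.
  case: ifP => vZ; first by rewrite subrr mul0r.
  rewrite subr0; case: ifP => vC; last by rewrite mul0r.
  case: (boolP (C \subset _)) => [/subsetP/(_ v vC)|_]; rewrite ?mulr0 //.
  by rewrite inE vZ vU.
have [[|v [|w []]] // _|b bP] := van (fun s => if s is [:: v] then u v else 0).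
  move=> C CD ZC /=; rewrite subr0 rmorphB !rmorphM /= !Eu //.
  by rewrite mulrCA subrr.
(* If [u] is the coboundary of [b], cancelling a nonzero coordinate of [t] at a vertex outside [Z]
   determines [b] on the linear space of [C]. *)
have Eb C : C \in faces D -> Z \proper C ->
    msubst (face_subst Z C) (b [::]) = (C \subset Z :|: U)%:R.
  move=> CD /properP[ZC [v vC vZ]].
  have /eqP := bP [:: v] erefl C CD ZC.
  rewrite /= subr0 rmorphB rmorphM /= Eu // -mulrBr mulf_eq0 => /orP[|]; last first.
    by rewrite subr_eq0 eq_sym => /eqP.
  rewrite /t msubst_varB /face_subst (negPf vZ) vC.
  by rewrite subr0 xvar_eq0.
(* All these linear spaces pass through the point of [Z], where [b] would then be both 1 and 0. *)
have Ept C p : Z \subset C ->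
    msubst (link_point Z) (msubst (face_subst Z C) p) = msubst (link_point Z) p.
  move=> /subsetP ZC; rewrite msubst_comp; apply: eq_msubst => v /=.
  rewrite /face_subst /link_point; case: ifP => vZ; first by rewrite rmorph1.
  by case: ifP => _; rewrite ?rmorph0 // msubst_var vZ.
have C2N : (C2 \subset Z :|: U) = false.
  have /properP[_ [v vC vZ]] := ZC2; apply/negP=> /subsetP/(_ _ vC).
  by rewrite inE (negPf vZ) (disjointFr C2U vC).
have := Ept C1 (b [::]) (proper_sub ZC1); rewrite Eb // C1U rmorph1.
rewrite -(Ept C2 _ (proper_sub ZC2)) Eb // C2N rmorph0 => /eqP.
by rewrite oner_eq0.
Qed.

(** Fixes the first [k] vertices of [C] at their coordinates in the point of [Z]. When [Z] lies in
    [C], the kernels run from the prime of the face [C] at [k = 0] to the maximal ideal of the point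
    at [k = #|C|]. *)
Definition chain_subst Z C k v : S :=
  if v \in take k (enum C) then (v \in Z)%:R else if v \in C then X v else 0.

Lemma face_prime_chain Z C : C \in faces D -> Z \subset C ->
  prime_chain (sr_ideal F D) (msubst_ker (link_point Z)) #|C|
    (fun k => msubst_ker (chain_subst Z C k)).
Proof.
move=> CD ZC; have sub_chain k l : (k <= l)%N ->
    sub_ideal (msubst_ker (chain_subst Z C k)) (msubst_ker (chain_subst Z C l)).
  move=> le_kl p pk; rewrite /msubst_ker.
  pose h v : S := if v \in take l (enum C) then (v \in Z)%:R else X v.
  have /(congr1 (msubst h)) := pk; rewrite rmorph0 msubst_comp => <-.
  apply: eq_msubst => v /=; rewrite /chain_subst.
  have [vk|vk] := boolP (v \in take k _).
    have -> : v \in take l (enum C).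
      by rewrite -(subnKC le_kl) takeD mem_cat vk.
    by rewrite rmorph_nat.
  have [vC|vC] := boolP (v \in C); first by rewrite msubst_var.
  by rewrite rmorph0; case: ifP => // /mem_take; rewrite mem_enum (negPf vC).
split.
- move=> i _; split; first exact: msubst_ker_prime.
  move=> p Ip; apply: (sub_chain 0) => //.
  have := sr_ideal_sub_link Ip CD (sub0set _).
  rewrite /msubst_ker => <-; apply: eq_msubst => v.
  by rewrite /chain_subst /face_subst take0 !inE.
- move=> i lt_i; split; first exact: sub_chain.
  have [v0 _] : exists v, v \in C by apply/card_gt0P; apply: leq_ltn_trans lt_i.
  have lt_i' : (i < size (enum C))%N by rewrite -cardE.
  pose v := nth v0 (enum C) i.
  have vC : v \in C by rewrite -mem_enum mem_nth.
  (* [X v] minus the coordinate of [v] lies in the next prime but not in this one. *)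
  move=> /(_ (X v - (v \in Z)%:R)); rewrite /msubst_ker !msubst_varB.
  rewrite /chain_subst vC (take_nth v0) // mem_rcons mem_head.
  have -> : (v \in take i (enum C)) = false.
    apply/negP=> vi; have := enum_uniq C.
    rewrite -(cat_take_drop i (enum C)) cat_uniq => /and3P[_ /hasPn H _].
    by have := H v; rewrite (drop_nth v0) // mem_head vi => /(_ isT).
  rewrite subrr => /(_ erefl)/eqP; rewrite subr_eq0 -mpolyC_nat.
  by rewrite (negPf (xvar_neqC _ _)).
have E p : msubst (chain_subst Z C #|C|) p = msubst (link_point Z) p.
  apply: eq_msubst => v; rewrite /chain_subst /link_point cardE take_size mem_enum.
  by case: ifP => // vC; rewrite vC (contraFF (subsetP ZC v) vC).
by split=> p; rewrite /msubst_ker E.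
Qed.

(** Cohen-Macaulayness at the point of [Z] would give a regular sequence as long as the height,
    which is at least [#|C|]. Being longer than [#|Z| + 1], it would make every cocycle of degree 1
    over the link ideal a coboundary. *)
Theorem not_cohen_macaulay_of_disconnected_link Z U C C1 C2 :
  (forall C, C \in faces D -> Z \subset C -> (C \subset Z :|: U) || [disjoint C & U]) ->
  C1 \in faces D -> C2 \in faces D -> Z \proper C1 -> Z \proper C2 ->
  C1 \subset Z :|: U -> [disjoint C2 & U] -> [disjoint Z & U] ->
  C \in faces D -> Z \subset C -> (#|Z|.+1 < #|C|)%N ->
  ~ cohen_macaulay (sr_ideal F D).
Proof.
move=> sep C1D C2D ZC1 ZC2 C1U C2U ZU CD ZC ltZC CM.
have chain := face_prime_chain CD ZC.
have [||d [[[fs [reg fsm <-]] _] [_ ht]]] := CM (msubst_ker (link_point Z)).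
- exact/msubst_ker_maximal/link_point_const.
- move=> p Ip; have [pr _ [PC _]] := chain; apply: PC.
  by have [_] := pr _ (leqnn _); apply.
apply: (koszul_nonvanishing sep C1D C2D ZC1 ZC2 C1U C2U ZU).
apply: (@koszul_vanishes_link _ _ (size fs)); last first.
  by rewrite add1n; apply: leq_trans ltZC (ht _ _ chain).
apply: regular_seq_koszul_vanishes => // [|f ffs]; first exact: sr_ideal_is_ideal.
have [q] := subr_msubst (link_point Z) f.
by rewrite (fsm f ffs) subr0; exists q.
Qed.

End StanleyReisner.

(** * Minimal nonfaces and induced 4-cycles *)

Section Coefficients.
Variables (n : nat) (R : comNzRingType).
Implicit Types (p q : {mpoly R[n]}) (m M : 'X_{1..n}).

Lemma mcoeffM_eq0 p q M :
  (forall m, (m <= M)%MM -> q@_m = 0) -> (p * q)@_M = 0.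
Proof.
move=> q0; rewrite mcoeffM big1 // => k /eqP def_M.
by rewrite q0 ?mulr0 // [X in (_ <= X)%MM]def_M lem_addl.
Qed.

Lemma mcoeffMX_eq0 p m M : ~~ (m <= M)%MM -> ('X_[m] * p)@_M = 0.
Proof.
move=> mM; rewrite mulrC; apply: mcoeffM_eq0 => k kM; rewrite mcoeffX.
by case: eqVneq => // E; rewrite E kM in mM.
Qed.

Lemma mcoeffXM p m k : ('X_[m] * p)@_(m + k) = p@_k.
Proof. by rewrite mulrC mcoeffMX. Qed.

Lemma mcoeffXM0 p m : ('X_[m] * p)@_m = p@_0.
Proof. by rewrite -{1}[m]addm0 mcoeffXM. Qed.

End Coefficients.

Section FaceCoefficients.
Variables (F : fieldType) (V : finType) (D : scomplex V).
Local Notation S := {mpoly F[#|V|]}.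
Local Notation X := (xvar F).
Local Notation U v := U_(enum_rank v)%MM.
Implicit Types (p q r : S) (A B : {set V}) (m : 'X_{1..#|V|}).

Lemma mpoly_split_const p :
  exists q : V -> S, p = (p@_0)%:MP + \sum_v X v * q v.
Proof.
have [q Ep] := subr_msubst (fun=> 0) p.
have [|c Ec] := msubst_const (h := fun=> 0) p; first by exists 0; rewrite mpolyC0.
exists q; suff -> : p@_0 = c.
  rewrite -Ec; apply/eqP; rewrite addrC -subr_eq Ep; apply/eqP.
  by apply: eq_bigr => v _; rewrite subr0 mulrC.
have /(congr1 (mcoeff 0%MM)) := Ep.
rewrite Ec mcoeffB mcoeffC eqxx mulr1 raddf_sum big1 => [/eqP|v _ /=].
  by rewrite subr_eq0 => /eqP.
rewrite subr0 mulrC mcoeffMX_eq0 //.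
by apply/mnm_lepP=> /(_ (enum_rank v)); rewrite mnm1E eqxx mnm0E.
Qed.

Lemma mset_mvars B m : (m <= mset B)%MM -> m = mset (mvars m).
Proof.
move/mnm_lepP=> mB; apply/mnmP=> i; rewrite -[i]enum_valK msetE inE.
by have := mB (enum_rank (enum_val i)); rewrite msetE; case: (_ \in B); case: (m _) => [|[]].
Qed.

Lemma msetU1 v A : v \notin A -> mset (v |: A) = (mset A + U v)%MM.
Proof.
move=> vA; apply/mnmP=> i; rewrite -[i]enum_valK mnmDE !msetE !inE mnm1E.
rewrite (inj_eq enum_rank_inj) eq_sym; move: (enum_val i) => w.
by case: eqVneq => [<-|_]; rewrite ?(negPf vA) ?addn0.
Qed.

Lemma mset_inj : injective (@mset V).
Proof. by move=> A B E; rewrite -[A]mvars_mset E mvars_mset. Qed.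

Lemma mdeg_mset A : mdeg (mset A) = #|A|.
Proof.
rewrite mdegE -sum1_card (reindex (@enum_rank V)) /=; last first.
  by apply: onW_bij; apply: enum_rank_bij.
by rewrite [RHS]big_mkcond; apply: eq_bigr => v _; rewrite msetE; case: (v \in A).
Qed.

Lemma sr_ideal_mcoeff r m :
  sr_ideal F D r -> mvars m \in faces D -> r@_m = 0.
Proof.
move=> Ir mD; apply/eqP; rewrite mcoeff_eq0; apply/negP=> mr.
by have := sr_ideal_mvars Ir mr; rewrite mD.
Qed.

(** Some generator of degree [s] has a term dividing the monomial of [A]. A proper divisor has a
    face as support and occurs in no element of the ideal, so the term is the monomial of [A]
    itself. *)
Lemma generated_in_degree_minimal_nonface A s :
  A \notin faces D -> (forall B, B \proper A -> B \in faces D) ->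
  generated_in_degree (sr_ideal F D) s -> s = #|A|.
Proof.
move=> AD minA gen.
have /gen[k [a [g [gI]]]] : sr_ideal F D 'X_[mset A].
  by apply: sr_idealX; rewrite mvars_mset.
move/mpolyP=> /(_ (mset A)); rewrite mcoeffX eqxx raddf_sum /=.
have [i /eqP gi _|g0] := pickP (fun i => (a i * g i)@_(mset A) != 0); last first.
  rewrite big1 => [/eqP|i _]; first by rewrite oner_eq0.
  by apply/eqP/negbFE/g0.
have [Ig hom_g] := gI i.
apply/eqP/negPn/negP => sA; apply: gi; apply: mcoeffM_eq0 => m mA.
have [mAeq|mA'] := eqVneq m (mset A).
  by rewrite mAeq (dhomog_nemf_coeff hom_g) //= mdeg_mset eq_sym.
apply: (sr_ideal_mcoeff Ig); apply: minA; rewrite properEneq -[A]mvars_mset.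
rewrite (mvars_le mA) andbT; apply: contra mA' => /eqP.
by rewrite mvars_mset (mset_mvars mA) => <-; rewrite mvars_mset.
Qed.

(** Among the divisors of the monomial of [t |: u], an element of the ideal can involve only the
    monomials of [u] and of [t |: u]. *)
Lemma mcoeffM_face (u : {set V}) z r t : 
  sr_ideal F D r -> t \notin u ->
  (forall A, A \subset t |: u -> A \notin faces D -> u \subset A) ->
  (z * r)@_(mset u) = z@_0 * r@_(mset u) /\
  (z * r)@_(mset u + U t) =
     z@_(U t) * r@_(mset u) + z@_0 * r@_(mset u + U t).
Proof.
move=> Ir tu minu; set M := (mset u + U t)%MM.
have MU : M = mset (t |: u) by rewrite msetU1.
(* The rest of [r] after removing these two terms; none of its monomials divides [M]. *)
pose r' := r - r@_(mset u) *: 'X_[mset u] - r@_M *: 'X_[M].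
have uM : (mset u == M) = false.
  apply/negbTE/eqP; rewrite MU => /mset_inj/setP/(_ t).
  by rewrite setU11 (negPf tu).
have r'0 m : (m <= M)%MM -> r'@_m = 0.
  rewrite MU => mM; rewrite !mcoeffB !mcoeffZ !mcoeffX.
  have [<-|um] := eqVneq (mset u) m.
    by rewrite [M == _]eq_sym uM mulr1 mulr0 subrr subr0.
  have [<-|Mm] := eqVneq M m; first by rewrite mulr0 mulr1 subr0 subrr.
  rewrite !mulr0 !subr0; apply: (sr_ideal_mcoeff Ir).
  have mA := mset_mvars mM; have mU := mvars_le mM; rewrite mvars_mset in mU.
  apply: contraNT um => mD; have um := minu _ mU mD.
  rewrite mA (inj_eq mset_inj) eqEsubset um; apply/subsetP=> v vm.
  have := subsetP mU v vm; rewrite !inE => /predU1P[vt|//].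
  case/negP: Mm; rewrite MU mA (inj_eq mset_inj) eqEsubset mU andbT.
  by rewrite subUset sub1set -vt vm.
have Er : r = r@_(mset u) *: 'X_[mset u] + r@_M *: 'X_[M] + r'.
  by rewrite /r' addrC -[r - _ - _]addrA -opprD subrK.
have MuN : ~~ (M <= mset u)%MM.
  by rewrite MU mset_le mvars_mset subUset sub1set (negPf tu).
have zr' m : (m <= M)%MM -> (z * r')@_m = 0.
  by move=> mM; apply: mcoeffM_eq0 => k km; apply/r'0/(lepm_trans km).
have zX c m k : (z * (c *: 'X_[m]))@_(m + k) = z@_k * c.
  by rewrite -scalerAr mcoeffZ mcoeffMX mulrC.
have Ez m : (m <= M)%MM -> (z * r)@_m =
    (z * (r@_(mset u) *: 'X_[mset u]))@_m + (z * (r@_M *: 'X_[M]))@_m.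
  by move=> mM; rewrite {1}Er mulrDr mulrDr mcoeffD mcoeffD zr' // addr0.
rewrite !Ez ?lepm_refl ?lem_addr //.
have -> : (z * (r@_M *: 'X_[M]))@_(mset u) = 0.
  by rewrite -scalerAr mulrC scalerAl -scalerAl mcoeffZ mcoeffMX_eq0 ?mulr0.
rewrite addr0 zX; split; first by rewrite -{1}[mset u]addm0 zX.
by rewrite -{1}[M]addm0 zX.
Qed.

End FaceCoefficients.

(** * The graded complex computing Tor *)

Section TorComplex.
Variables (n : nat) (F : fieldType) (I : {mpoly F[n]} -> Prop).
Variable C : graded_resolution I.
Local Notation S := {mpoly F[n]}.

Lemma res_diffK i : res_diff C i.+1 *m res_diff C i = 0.
Proof.
apply/row_matrixP=> a; rewrite row0 row_mul.
by apply/(res_exactS (g := C)); exists (delta_mx 0 a); rewrite -rowE.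
Qed.

Lemma tor_diffK i : tor_diff C i.+1 *m tor_diff C i = 0.
Proof. by rewrite /tor_diff -map_mxM /= res_diffK map_mx0. Qed.

Lemma tor_diff_deg i a b : gen_deg (g := C) a != gen_deg (g := C) b ->
  tor_diff C i a b = 0.
Proof.
rewrite mxE neq_ltn => /orP[lt_ab|lt_ba]; first by rewrite res_diff_eq0 ?mcoeff0.
have hom := res_diff_homog (g := C) (ltnW lt_ba).
by rewrite (dhomog_nemf_coeff hom) //= mdeg0 eq_sym -lt0n subn_gt0.
Qed.

Lemma deg_part_tor_diff i j :
  deg_part C i.+1 j *m tor_diff C i = tor_diff C i *m deg_part C i j.
Proof.
apply/matrixP=> a b; rewrite mul_diag_mx mul_mx_diag !mxE -/(tor_diff C i a b).
have [<-|ab] := eqVneq (gen_deg (g := C) a) (gen_deg (g := C) b).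
  by rewrite mulrC.
have := tor_diff_deg ab; rewrite mxE => ->; by rewrite mulr0 mul0r.
Qed.

Lemma tor_boundaries_sub i j :
  (tor_boundaries C i.+1 j <= tor_cycles C i.+1 j)%MS.
Proof.
rewrite sub_capmx /tor_boundaries deg_part_tor_diff submxMl /= -deg_part_tor_diff.
by apply/sub_kermxP; rewrite -mulmxA tor_diffK mulmx0.
Qed.

(** The boundaries lie in the cycles, so the truncated subtraction in [tor_dim] vanishes only for
    equal ranks, hence equal spaces. *)
Lemma tor_dim_eq0 i j :
  tor_dim C i.+1 j = 0%N -> (tor_cycles C i.+1 j <= tor_boundaries C i.+1 j)%MS.
Proof.
move=> /eqP; rewrite subn_eq0 => le_rk.
by rewrite -(mxrank_leqif_sup (tor_boundaries_sub i j)) eqn_leq le_rk mxrankS ?tor_boundaries_sub.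
Qed.

End TorComplex.

(** * Induced 4-cycles and the Betti number in position (2,4) *)

Section Cochain.
Variables (F : fieldType) (V : finType) (a b c d : V).
Local Notation S := {mpoly F[#|V|]}.
Local Notation U v := U_(enum_rank v)%MM.
Variables (k : nat) (r : 'I_k -> S).
Implicit Types z : 'rV[S]_k.

(* Read on a syzygy [z] of the relations [r], this is the coefficient of
   [x_c x_d] in the coordinate of [z] along the generator [x_a x_b]. *)
Definition cochain z : F :=
  \sum_e ((z 0 e)@_(mset [set c; d]) * (r e)@_(mset [set a; b]) +
          (z 0 e)@_(U c) * (r e)@_(mset [set a; b] + U d) +
          (z 0 e)@_(U d) * (r e)@_(mset [set a; b] + U c)).

Lemma cochainD z z' : cochain (z + z') = cochain z + cochain z'.
Proof.
rewrite -big_split; apply: eq_bigr => e _ /=; rewrite mxE.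
move: (z 0 e) (z' 0 e) => p q; rewrite 3!mcoeffD.
move: (p@__) (p@__) (p@__) (q@__) (q@__) (q@__) => *; ring.
Qed.

Lemma cochainZ x z : cochain (x%:MP *: z) = x * cochain z.
Proof.
rewrite mulr_sumr; apply: eq_bigr => e _ /=.
rewrite mxE; move: (z 0 e) => p; rewrite 3!mcoeffCM.
move: (p@__) (p@__) (p@__) => *; ring.
Qed.

Lemma cochain0 : cochain 0 = 0.
Proof. by rewrite -[0](scale0r 0) -[0 in X in X *: _]mpolyC0 cochainZ mul0r. Qed.

Lemma cochain_sum (T : finType) (z : T -> 'rV_k) :
  cochain (\sum_i z i) = \sum_i cochain (z i).
Proof. exact: (big_morph cochain cochainD cochain0). Qed.

End Cochain.

Section InducedFourCycle.
Variables (F : fieldType) (V : finType) (D : scomplex V) (a b c d : V).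
Local Notation S := {mpoly F[#|V|]}.
Local Notation X := (xvar F).
Local Notation U v := U_(enum_rank v)%MM.
Local Notation I := (sr_ideal F D).
Hypotheses (uniq_abcd : uniq [:: a; b; c; d]).
Hypotheses (abD : [set a; b] \notin faces D) (cdD : [set c; d] \notin faces D).
Hypotheses (acD : [set a; c] \in faces D) (adD : [set a; d] \in faces D).
Hypotheses (bcD : [set b; c] \in faces D) (bdD : [set b; d] \in faces D).

Let u := [set a; b].
Let w := [set c; d].

Variable C : graded_resolution I.
Local Notation d0 := (res_diff C 0).
Local Notation d1 := (res_diff C 1).

(** The resolution is arbitrary, so its module in degree 0 may have several generators; the
    composite with the augmentation gives elements of [I]. *)
Definition res_relation (e : 'I_(res_rank C 1)) : S := (d0 *m res_aug C) e 0.
Local Notation r := res_relation.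

Local Notation cochain := (cochain a b c d r).

Lemma res_relation_ideal e : I (r e).
Proof.
have := (res_exact0 (g := C) (row e d0)).2; rewrite -row_mul mxE; apply.
by exists (delta_mx 0 e); rewrite -rowE.
Qed.

Lemma res_relation_homog e : r e \is (gen_deg (g := C) e).-homog.
Proof.
rewrite /res_relation mxE; apply: rpred_sum => f _.
have [le_fe|lt_ef] := leqP (gen_deg (g := C) f) (gen_deg (g := C) e).
  rewrite -(subnK le_fe); apply: dhomogM; first exact: res_diff_homog.
  exact: res_aug_homog.
by rewrite res_diff_eq0 // mul0r rpred0.
Qed.

Lemma sum_relations (z : 'rV_(res_rank C 1)) :
  \sum_e z 0 e * r e = (z *m d0 *m res_aug C) 0 0.
Proof. by rewrite -mulmxA mxE. Qed.

(** The pairs [{a, t}] and [{b, t}] are faces, so a nonface inside the triangle needs both [a] and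
    [b]. *)
Lemma ab_sub_nonface t (A : {set V}) :
  t \in w -> A \subset t |: u -> A \notin faces D -> u \subset A.
Proof.
move=> tw At AD; have [aA|aA] := boolP (a \in A); last first.
  case/negP: AD; have [btD ] : [set b; t] \in faces D.
    by move: tw; rewrite !inE => /orP[]/eqP->.
  apply: (faces_down btD); apply/subsetP=> v vA.
  have := subsetP At v vA; rewrite !inE.
  by case: (eqVneq v a) => [va|_]; [rewrite va (negPf aA) in vA|rewrite orbC].
have [bA|bA] := boolP (b \in A); last first.
  case/negP: AD; have [atD ] : [set a; t] \in faces D.
    by move: tw; rewrite !inE => /orP[]/eqP->.
  apply: (faces_down atD); apply/subsetP=> v vA.
  have := subsetP At v vA; rewrite !inE.
  by case: (eqVneq v b) => [vb|_]; [rewrite vb (negPf bA) in vA|rewrite orbF orbC].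
by apply/subsetP=> v; rewrite !inE => /orP[]/eqP->.
Qed.

Lemma cd_notin_ab t : t \in w -> t \notin u.
Proof.
move: uniq_abcd; rewrite /= !inE !negb_or => /and4P[/and3P[_ ac ad] /andP[bc bd] _ _].
by case/orP=> /eqP->; rewrite ![_ == a]eq_sym ![_ == b]eq_sym ?ac ?ad.
Qed.

Let cw : c \in w. Proof. by rewrite !inE eqxx. Qed.
Let dw : d \in w. Proof. by rewrite !inE eqxx orbT. Qed.

Lemma mset_cd : mset w = (U c + U d)%MM.
Proof.
have cd : c \notin [set d].
  by move: uniq_abcd; rewrite /= !inE => /and4P[_ _ ].
rewrite /w msetU1 // -[[set d]]setU0 msetU1 ?inE //.
by apply/mnmP=> i; rewrite !mnmDE addnC -[i]enum_valK msetE inE.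
Qed.

Lemma cd_neq : enum_rank c != enum_rank d.
Proof.
by rewrite (inj_eq enum_rank_inj); move: uniq_abcd; rewrite /= !inE => /and4P[].
Qed.

Lemma mnm1_enum_rank_le (v : V) (m : 'X_{1..#|V|}) : (U v <= m)%MM = (m (enum_rank v) != 0%N).
Proof. exact: lep1mP. Qed.

(** For [t = c] the value is the coefficient of [x_a x_b x_d] in the sum of the [z_e r_e], which is
    0 for a syzygy; [t = d] is symmetric, and for any other [t] every coefficient of [X t *: z] read
    by [cochain] is 0. *)
Lemma cochainX (t : V) (z : 'rV_(res_rank C 1)) :
  z *m d0 = 0 -> cochain (X t *: z) = 0.
Proof.
move=> zd0; have rel0 : \sum_e z 0 e * r e = 0.
  by rewrite sum_relations zd0 mul0mx mxE.
have term s : s \in w -> \sum_e ((z 0 e)@_(U s) * (r e)@_(mset u) +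
    (z 0 e)@_0 * (r e)@_(mset u + U s)) = 0.
  move=> sw; rewrite -[RHS](mcoeff0 _ (mset u + U s)) -rel0 raddf_sum.
  apply: eq_bigr => e _ /=.
  have [_ ->//] := mcoeffM_face (z 0 e) (res_relation_ideal e) (cd_notin_ab sw)
    (fun A => @ab_sub_nonface s A sw).
rewrite /cochain; have [tc|tc] := eqVneq t c.
  rewrite -[RHS](term d dw); apply: eq_bigr => e _; rewrite mxE tc mset_cd mcoeffXM.
  rewrite mcoeffXM0 [X in _ + X * _]mcoeffMX_eq0 ?mul0r ?addr0 //.
  by rewrite mnm1_enum_rank_le mnm1E [_ == enum_rank c]eq_sym (negPf cd_neq).
have [td|td] := eqVneq t d.
  rewrite -[RHS](term c cw); apply: eq_bigr => e _; rewrite mxE td mset_cd addmC mcoeffXM.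
  rewrite mcoeffXM0 [X in _ + X * _ + _]mcoeffMX_eq0 ?mul0r ?addr0 //.
  by rewrite mnm1_enum_rank_le mnm1E (negPf cd_neq).
have tcd s : s \in w -> (s == t) = false.
  by case/set2P=> ->; rewrite eq_sym ?(negPf tc) ?(negPf td).
apply: big1 => e _; rewrite mxE !mcoeffMX_eq0 ?mul0r ?addr0 // mnm1_enum_rank_le ?mnm1E;
  rewrite ?(inj_eq enum_rank_inj) ?(tcd c) ?(tcd d) //.
by rewrite msetE !inE (negPf td) (negPf tc).
Qed.

(** Rows of [d1] are syzygies, so their multiples by variables contribute nothing. *)
Lemma cochain_diff (v : 'rV_(res_rank C 2)) :
  cochain (v *m d1) = \sum_g (v 0 g)@_0 * cochain (row g d1).
Proof.
rewrite mulmx_sum_row cochain_sum; apply: eq_bigr => g _.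
have [q Eq] := mpoly_split_const (v 0 g).
rewrite {1}Eq scalerDl cochainD cochainZ scaler_suml cochain_sum big1 ?addr0 //.
move=> t _; rewrite -scalerA; apply: cochainX.
by rewrite -scalemxAl -row_mul res_diffK row0 scaler0.
Qed.

(** All products of coefficients read by [cochain] have total degree 4. *)
Lemma cochain_deg g : gen_deg (g := C) g != 4%N -> cochain (row g d1) = 0.
Proof.
move=> deg_g; apply: big1 => e _; rewrite !mxE.
have [le_eg|lt_ge] := leqP (gen_deg (g := C) e) (gen_deg (g := C) g); last first.
  by rewrite res_diff_eq0 // !mcoeff0 !mul0r !addr0.
have hd := res_diff_homog (g := C) le_eg; have hr := res_relation_homog e.
have z m1 m2 : (mdeg m1 + mdeg m2 = 4)%N -> (d1 g e)@_m1 * (r e)@_m2 = 0.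
  move=> deg4; have [E|ne] := eqVneq (mdeg m2) (gen_deg (g := C) e); last first.
    by rewrite (dhomog_nemf_coeff hr ne) mulr0.
  rewrite (dhomog_nemf_coeff hd) ?mul0r //=; apply: contra deg_g => /eqP E1.
  by rewrite -deg4 E E1 subnK.
have deg_u : mdeg (mset u) = 2%N.
  rewrite mdeg_mset cards2; move: uniq_abcd.
  by rewrite /= !inE !negb_or => /and4P[/and3P[-> _ _]].
have deg_w : mdeg (mset w) = 2%N by rewrite mset_cd mdegD !mdeg1.
by rewrite !z ?addr0 // ?mdegD ?mdeg1 ?deg_u ?deg_w.
Qed.

Lemma nonboundary_cycle : exists2 v : 'rV_(res_rank C 2),
  map_mx (mcoeff 0%MM) v *m tor_diff C 1 = 0 & cochain (v *m d1) != 0.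
Proof.
have Iu : I 'X_[mset u] by apply: sr_idealX; rewrite mvars_mset.
have Iw : I 'X_[mset w] by apply: sr_idealX; rewrite mvars_mset.
have HI := sr_ideal_is_ideal F D.
(* [e] is a preimage of 1 modulo [I]; multiplied by either nonface monomial it comes from [d0]. *)
have [e eP] := res_aug_onto C 1.
have lift m : I 'X_[m] -> exists f, 'X_[m] *: e = f *m d0.
  move=> Im; apply/(res_exact0 (g := C)); rewrite -scalemxAl mxE.
  exact: is_idealMr.
have [[fu fuP] [fw fwP]] := (lift _ Iu, lift _ Iw).
(* The Koszul relation between the two nonface monomials, lifted to the resolution. *)
pose z := 'X_[mset u] *: fw - 'X_[mset w] *: fu.
have /(res_exactS (g := C))[v vP] : z *m d0 = 0.
  rewrite mulmxBl -!scalemxAl -fuP -fwP !scalerA mulrC subrr //.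
have nu t : (t \in w) -> ~~ (mset u <= U t)%MM.
  move=> tw; rewrite mset_le; apply/subsetPn; exists a; first by rewrite !inE eqxx.
  rewrite inE mnm1E (inj_eq enum_rank_inj); have := cd_notin_ab tw.
  by rewrite !inE negb_or => /andP[/negPf->].
have n0 (A : {set V}) x : x \in A -> ~~ (mset A <= 0)%MM.
  move=> xA; rewrite mset_le; apply/subsetPn; exists x => //.
  by rewrite inE mnm0E.
exists v.
  rewrite /tor_diff -map_mxM -vP; apply/matrixP=> i j; rewrite !mxE /=.
  rewrite mcoeffB !mcoeffMX_eq0 ?subrr //; first exact: n0 cw.
  by apply: (n0 _ a); rewrite !inE eqxx.
(* Only the coefficient of [x_c x_d] in [z] contributes, and it comes from [fu]. The value is minus
   the constant coefficient of the image of [e], that is -1. *)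
rewrite -vP; have -> : cochain z = - (\sum_e fu 0 e * r e)@_(mset u).
  rewrite raddf_sum -sumrN; apply: eq_bigr => g _; rewrite !mxE !mcoeffB.
  have -> : ('X_[mset u] * fw 0 g)@_(mset w) = 0.
    apply: mcoeffMX_eq0; rewrite mset_le mvars_mset; apply/subsetPn; exists a.
      by rewrite !inE eqxx.
    by apply/negP=> /cd_notin_ab; rewrite !inE eqxx.
  rewrite mcoeffXM0 !(mcoeffMX_eq0 _ (nu _ _)) //.
  have wU s t : s != t -> s \in w -> ~~ (mset w <= U t)%MM.
    move=> st sw; rewrite mset_le; apply/subsetPn; exists s => //.
    by rewrite inE mnm1E (inj_eq enum_rank_inj) [t == s]eq_sym (negPf st).
  have cd : c != d by rewrite -(inj_eq enum_rank_inj) cd_neq.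
  have dc : d != c by rewrite eq_sym.
  rewrite (mcoeffMX_eq0 _ (wU d c dc dw)) (mcoeffMX_eq0 _ (wU c d cd cw)) /=.
  rewrite !subr0 !mul0r !addr0 sub0r mulNr.
  have [-> _] := mcoeffM_face (fu 0 g) (res_relation_ideal g) (cd_notin_ab cw)
    (fun A => @ab_sub_nonface c A cw).
  by [].
rewrite sum_relations -fuP -scalemxAl mxE mcoeffXM0 oppr_eq0.
have : (1 - (e *m res_aug C) 0 0)@_0 = 0.
  apply: (sr_ideal_mcoeff eP); apply: (faces_down acD).
  by apply/subsetP=> x; rewrite inE mnm0E.
rewrite mcoeffB mcoeff1 eqxx => /eqP; rewrite subr_eq0 => /eqP <-.
exact: oner_neq0.
Qed.

(** [cochain] composed with [d1] induces a linear form [L] that kills boundaries but not the cycle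
    from [nonboundary_cycle]; restricting that cycle to degree 4 does not change its value. *)
Lemma tor_dim_induced_four_cycle : tor_dim C 2 4 <> 0%N.
Proof.
move=> /tor_dim_eq0 sub; have [v vd1 cv] := nonboundary_cycle.
pose y := map_mx (mcoeff 0%MM) v *m deg_part C 2 4.
pose L : 'cV_(res_rank C 2) := \col_g cochain (row g d1).
have /(submx_trans)/(_ sub) : (y <= tor_cycles C 2 4)%MS.
  rewrite sub_capmx submxMl /=; apply/sub_kermxP.
  by rewrite -mulmxA deg_part_tor_diff mulmxA vd1 mul0mx.
case/submxP=> x Ex; case/eqP: cv.
have -> : cochain (v *m d1) = (y *m L) 0 0.
  rewrite cochain_diff mxE; apply: eq_bigr => g _.
  rewrite /y /deg_part mul_mx_diag !mxE; have [_|ne] := eqVneq (gen_deg (g := C) g) 4%N.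
    by rewrite mulr1.
  by rewrite cochain_deg // !mulr0.
rewrite Ex /tor_boundaries -!mulmxA; suff -> : tor_diff C 2 *m L = 0.
  by rewrite !mulmx0 mxE.
apply/matrixP=> h j; rewrite !mxE.
transitivity (cochain (row h (res_diff C 2) *m d1)).
  by rewrite cochain_diff; apply: eq_bigr => g _; rewrite !mxE.
by rewrite -row_mul res_diffK row0 cochain0.
Qed.

End InducedFourCycle.

Theorem nonlinear_of_induced_four_cycle (F : fieldType) (V : finType)
    (D : scomplex V) (a b c d : V) :
  uniq [:: a; b; c; d] ->
  [set a; b] \notin faces D -> [set c; d] \notin faces D ->
  [set a; c] \in faces D -> [set a; d] \in faces D ->
  [set b; c] \in faces D -> [set b; d] \in faces D ->
  ~ has_linear_resolution (sr_ideal F D).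
Proof.
move=> Uabcd abD cdD acD adD bcD bdD [s s1 [gen lin]].
have s2 : s = 2%N.
  rewrite (generated_in_degree_minimal_nonface abD _ gen) => [|B /properP[Bab [v vab vB]]].
    by rewrite cards2; move: Uabcd; rewrite /= !inE !negb_or => /and4P[/and3P[-> ]].
  have [aB|aB] := boolP (a \in B).
    apply: (faces_down acD); apply/subsetP=> x xB; have := subsetP Bab x xB.
    rewrite !inE => /orP[-> //|/eqP xb].
    by move: vab vB; rewrite !inE => /orP[]/eqP->; rewrite ?aB // -xb xB.
  apply: (faces_down bcD); apply/subsetP=> x xB; have := subsetP Bab x xB.
  by rewrite !inE => /orP[/eqP xa|-> //]; rewrite -xa xB in aB.
(* [betti_is] provides some resolution with vanishing Tor, so the nonvanishing was proved for an
   arbitrary one. A 2-linear resolution allows only [j = 3] when [i = 2]. *)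
have [|C] := lin 2%N 4%N isT; first by rewrite s2.
exact: (tor_dim_induced_four_cycle Uabcd abD cdD acD adD bcD bdD).
Qed.

(** * The graph K_2 x K_n *)

Section Faces.
Variables (V : finType) (G : sgraph V).
Implicit Types (A : {set V}) (u v : V).

Lemma total_cut2P A :
  reflect (exists u v, [/\ u != v, ~~ G u v, u \notin A & v \notin A])
          (A \in faces (total_cut 2 G)).
Proof.
rewrite inE; apply: (iffP existsP) => [[B /andP[/imsetP[M]]]|[u [v [uv Guv uA vA]]]].
  rewrite !inE => /andP[/'forall_implyP ind /cards2P[u [v [uv EM]]]] -> AM.
  exists u, v; move: ind AM; rewrite {}EM => ind AM.
  have uM : u \in [set u; v] by rewrite !inE eqxx.
  have vM : v \in [set u; v] by rewrite !inE eqxx orbT.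
  split=> //; first by have /'forall_implyP/(_ v vM) := ind u uM.
    by apply/negP=> /(subsetP AM); rewrite inE uM.
  by apply/negP=> /(subsetP AM); rewrite inE vM.
exists (~: [set u; v]); apply/andP; split.
  apply/imsetP; exists [set u; v] => //; rewrite !inE cards2 uv andbT.
  apply/'forall_implyP=> w /set2P ww; apply/'forall_implyP=> z /set2P.
  by case: ww => -> [] ->; rewrite ?(@adj_irr _ G) // (@adj_sym _ G).
apply/subsetP=> w wA; rewrite !inE negb_or.
by apply/andP; split; apply: contraTneq wA => ->.
Qed.

Lemma dual_total_cut2P A :
  reflect (forall u v, u \in A -> v \in A -> u != v -> G u v)
          (A \in faces (alexander_dual (total_cut 2 G))).
Proof.
rewrite inE; apply: (iffP idP) => [/total_cut2P H u v uA vA uv|H].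
  apply/negPn/negP=> Guv; case: H; exists u, v.
  by rewrite !inE !negbK.
apply/total_cut2P=> -[u [v [uv /negP Guv]]]; rewrite !inE !negbK => uA vA.
by apply: Guv; apply: H.
Qed.

Lemma dual_total_cut2_pair u v :
  ([set u; v] \in faces (alexander_dual (total_cut 2 G))) = (u == v) || G u v.
Proof.
apply/dual_total_cut2P/idP => [H|Guv w z /set2P ww /set2P zz].
  have [//|uv] := eqVneq u v; apply: H => //; rewrite !inE eqxx ?orbT //.
case: ww zz Guv => -> [] ->; rewrite ?eqxx //; first by case: eqVneq.
by rewrite (@adj_sym _ G) eq_sym; case: eqVneq.
Qed.

End Faces.

Section Prism.
Variables (F : fieldType) (n : nat).
Local Notation V := (bool * 'I_n)%type.
Local Notation D := (total_cut 2 (K2K n)).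
Local Notation K := (alexander_dual D).
Local Notation x i := (false, i).
Local Notation y i := (true, i).

Lemma K2KE (u v : V) : K2K n u v = (u.1 == v.1) (+) (u.2 == v.2).
Proof. by rewrite /= /K2K_adj; case: (u.1 == _); case: (u.2 == _). Qed.

Section TwoIndices.
Variables (i j : 'I_n).
Hypothesis ij : i != j.

Let ijF : (i == j) = false. Proof. exact: negPf. Qed.
Let jiF : (j == i) = false. Proof. by rewrite eq_sym. Qed.

Lemma not_linear_dual_prism : ~ has_linear_resolution (sr_ideal F K).
Proof.
(* The pairs [x i, y j] and [x j, y i] are the diagonals of the induced 4-cycle. *)
apply: (@nonlinear_of_induced_four_cycle _ _ _ (x i) (y j) (x j) (y i));
  by rewrite ?dual_total_cut2_pair ?K2KE /= ?inE ?xpair_eqE ?ijF ?jiF ?eqxx.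
Qed.

(** A face containing the complement of [Q] misses one of the two diagonals of the 4-cycle on [Q],
    so the link consists of two disjoint edges, one of which is taken as [U]. *)
Lemma not_cohen_macaulay_prism : ~ cohen_macaulay (sr_ideal F D).
Proof.
pose Q : {set V} := setX [set: bool] [set i; j].
have QE v : (v \in Q) = (v.2 == i) || (v.2 == j).
  by rewrite !inE.
have avoid C : C \in faces D -> ~: Q \subset C ->
    (x i \notin C) && (y j \notin C) || (x j \notin C) && (y i \notin C).
  move=> /total_cut2P[[e k] [[f l] [uv Guv uC vC]]] QC.
  have inQ v : v \notin C -> (v.2 == i) || (v.2 == j).
    by rewrite -QE; apply: contraR => vQ; apply: (subsetP QC); rewrite inE.
  have uQ := inQ _ uC; have vQ := inQ _ vC.
  move: uQ vQ uv Guv uC vC; rewrite K2KE xpair_eqE /=.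
  by case: e f => [] [] /orP[]/eqP-> /orP[]/eqP->;
    rewrite ?eqxx ?ijF ?jiF //= => _ _ -> ->; rewrite ?orbT.
have nonface (u v : V) : u != v -> ~~ K2K n u v -> ~: [set u; v] \in faces D.
  move=> uv Guv; apply/total_cut2P; exists u, v.
  by rewrite !inE !eqxx uv Guv orbT.
have U1 : x j != y i by [].
have C1D : ~: [set x j; y i] \in faces D.
  by apply: nonface => //; rewrite K2KE /= jiF.
have C2D : ~: [set x i; y j] \in faces D.
  by apply: nonface => //; rewrite K2KE /= ijF.
have QC1 : ~: Q \proper ~: [set x j; y i].
  apply/properP; split; last by exists (x i); rewrite inE ?QE ?inE /= ?xpair_eqE ?eqxx ?ijF.
  by rewrite setCS; apply/subsetP=> v /set2P[]->; rewrite QE /= eqxx ?orbT.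
have QC2 : ~: Q \proper ~: [set x i; y j].
  apply/properP; split; last by exists (x j); rewrite inE ?QE ?inE /= ?xpair_eqE ?eqxx ?jiF ?orbT.
  by rewrite setCS; apply/subsetP=> v /set2P[]->; rewrite QE /= eqxx ?orbT.
apply: (not_cohen_macaulay_of_disconnected_link (U := [set x i; y j])
   _ C1D C2D QC1 QC2 _ _ _ C1D (proper_sub QC1)).
- move=> C CD QC; have /orP[/andP[xC yC]|/andP[xC yC]] := avoid C CD QC.
    apply/orP; right; rewrite disjoint_sym disjoints_subset.
    by apply/subsetP=> v /set2P[]->; rewrite inE.
  apply/orP; left; apply/subsetP=> v vC; rewrite !inE.
  have vx : v != x j by apply: contraTneq vC => ->.
  have vy : v != y i by apply: contraTneq vC => ->.
  case: v vx vy {vC} => e k; rewrite !xpair_eqE /=.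
  by case: e (k == i) (k == j) => [] [] [].
- apply/subsetP=> -[e k]; rewrite !in_setU !in_setC QE !inE !xpair_eqE /=.
  by case: e (k == i) (k == j) => [] [] [].
- by rewrite disjoint_sym disjoints_subset setCK.
- rewrite disjoint_sym disjoints_subset setCK.
  by apply/subsetP=> v /set2P[]->; rewrite QE /= eqxx ?orbT.
- have -> : #|~: [set x j; y i]| = (#|~: Q| + 2)%N; last by rewrite addn2.
  have := cardsC Q; have := cardsC [set x j; y i]; rewrite cards2 /=.
  have -> : #|Q| = 4%N; last first.
    by move=> <-; move: #|~: Q| #|~: [set _; _]| => k l; lia.
  by rewrite cardsX cardsT card_bool cards2 ij.
Qed.

(** The link of [x i] in the clique complex is the simplex on the other [x k] together with the
    isolated vertex [y i]; the clique of all [x k] has size [n > 2]. *)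
Lemma not_cohen_macaulay_dual_prism : (2 < n)%N -> ~ cohen_macaulay (sr_ideal F K).
Proof.
move=> n2; pose X : {set V} := [set x k | k in 'I_n].
have XD : X \in faces K.
  apply/dual_total_cut2P=> _ _ /imsetP[k _ ->] /imsetP[l _ ->].
  by rewrite K2KE xpair_eqE /=.
have xX k : x k \in X by apply: imset_f.
have yX k : y k \notin X by apply/imsetP=> -[].
have xy : [set x i; y i] \in faces K by rewrite dual_total_cut2_pair K2KE /= eqxx.
have px : [set x i] \proper [set x i; y i].
  apply/properP; split; first by apply/subsetP=> v; rewrite !inE => ->.
  by exists (y i); rewrite !inE // eqxx orbT.
have pX : [set x i] \proper X.
  apply/properP; split; first by rewrite sub1set.
  by exists (x j) => //; rewrite inE xpair_eqE jiF.
apply: (not_cohen_macaulay_of_disconnected_link (U := [set y i])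
   _ xy XD px pX _ _ _ XD (proper_sub pX)) => //.
(* No vertex is adjacent to both [x i] and [y i], so a clique containing both has no other
   vertex. *)
- move=> C /dual_total_cut2P cliqueC; rewrite sub1set => xC.
  case: (boolP (y i \in C)) => yC; last first.
    by rewrite disjoint_sym disjoints1 yC orbT.
  apply/orP; left; apply/subsetP=> -[e k] vC; rewrite !inE.
  apply: contraT; rewrite negb_or => /andP[vx vy].
  have := cliqueC _ _ vC xC vx; have := cliqueC _ _ vC yC vy; rewrite !K2KE /=.
  by move: vx vy; rewrite !xpair_eqE {vC}; case: e => /=; case: (k == i).
- by rewrite disjoint_sym disjoints1.
- by rewrite disjoint_sym disjoints1 inE.
- by rewrite cards1 card_imset ?card_ord // => k l [].
Qed.

(** The set [X] and the complement of the edge [x i, y i] each leave a clique outside, while their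
    proper subsets leave a nonadjacent pair outside. The sizes [n] and [2n - 2] agree only for
    [n = 2]. *)
Lemma not_linear_prism : (2 < n)%N -> ~ has_linear_resolution (sr_ideal F D).
Proof.
move=> n2 [s _ [gen _]]; pose X : {set V} := [set x k | k in 'I_n].
have xX k : x k \in X by apply: imset_f.
have yX k : y k \notin X by apply/imsetP=> -[].
have sX : s = #|X|.
  apply: (generated_in_degree_minimal_nonface _ _ gen) => [|B /properP[BX [v]]].
    apply/total_cut2P=> -[[e k] [[f l] [uv + uX vX]]].
    case: e f uX vX uv => [] []; rewrite ?xX // => _ _.
    by rewrite K2KE xpair_eqE /= => ->.
  case/imsetP=> k _ -> kB; apply/total_cut2P.
  have [l lk] : exists l, k != l.
    by case: (eqVneq k i) => [->|ki]; [exists j|exists i].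
  exists (x k), (y l); rewrite K2KE /= (negPf lk); split=> //.
  by apply: contra (yX l); apply: (subsetP BX).
have sQ : s = #|~: [set x i; y i]|.
  apply: (generated_in_degree_minimal_nonface _ _ gen) => [|B /properP[BX [[e k]]]].
    apply/total_cut2P=> -[u [v [uv + +]]]; rewrite !in_setC !negbK => + /set2P uu /set2P vv.
    by case: uu vv uv => -> [] ->; rewrite ?K2KE /= eqxx.
  move=> ki kB; apply/total_cut2P; rewrite !inE !xpair_eqE in ki; exists (e, k), (~~ e, i).
  have {}ki : (k == i) = false by case: e ki {kB}; case: (k == i).
  split=> //; [by rewrite xpair_eqE ki andbF|by rewrite K2KE /= ki; case: e {kB}|].
  by apply/negP=> /(subsetP BX); rewrite !inE !xpair_eqE eqxx; case: e {kB}.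
have := cardsC [set x i; y i]; rewrite -sQ sX card_imset; last by move=> k l [].
by rewrite cards2 /= card_prod card_bool card_ord; lia.
Qed.

End TwoIndices.
End Prism.

(** * Resolutions for the 4-cycle *)

Section SeqMatrix.
Variable R : comNzRingType.

Definition seq_mx (L : seq (seq R)) m n : 'M[R]_(m, n) :=
  \matrix_(i, j) nth 0 (nth [::] L i) j.

Lemma seq_rowP n (v : 'rV[R]_n) :
  exists2 s, size s = n & v = seq_mx [:: s] 1 n.
Proof.
exists [seq v 0 i | i <- enum 'I_n]; first by rewrite size_map size_enum_ord.
apply/rowP=> i; rewrite mxE /= (nth_map i) ?size_enum_ord //.
by rewrite nth_ord_enum.
Qed.

End SeqMatrix.

Section AbstractComplexes.
Variable R : idomainType.

(** All relations between [x] and [y] are multiples of the Koszul relation. *)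
Definition reg_pair (x y : R) :=
  forall p q, x * p = y * q -> exists r, p = y * r /\ q = x * r.

Lemma reg_pair_syzygy x y p q : reg_pair x y -> x * p + y * q = 0 ->
  exists r, p = y * r /\ q = - (x * r).
Proof.
move=> reg E; have [|r [-> Er]] := reg p (- q).
  by rewrite mulrN; apply/eqP; rewrite -addr_eq0 E.
by exists r; rewrite -Er opprK.
Qed.

Section FourCycleComplex.
Variables (a b c d : R).

Definition c4_rank i := match i with 0 => 1 | 1 => 4 | 2 => 4 | 3 => 1 | _ => 0 end%N.

(** The ideal of the four edges is the product of [(a, c)] and [(b, d)]. The rows of the second
    matrix are the relations between consecutive edges, and the last row is a relation among
    those. *)
Definition c4_diff i : 'M[R]_(c4_rank i.+1, c4_rank i) :=
  match i return 'M[R]_(c4_rank i.+1, c4_rank i) with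
  | 0 => seq_mx [:: [:: a * b]; [:: b * c]; [:: c * d]; [:: d * a]] 4 1
  | 1 => seq_mx [:: [:: c; - a; 0; 0]; [:: d; 0; 0; - b];
                    [:: 0; d; - b; 0]; [:: 0; 0; a; - c]] 4 4
  | 2 => seq_mx [:: [:: d; - c; a; b]] 1 4
  | _ => 0
  end.

Hypotheses (a0 : a != 0) (d0 : d != 0).
Hypotheses (reg_ac : reg_pair a c) (reg_bd : reg_pair b d).
Hypothesis reg_ad : reg_pair a d.
Hypothesis reg_acd : forall t p q, d * t = a * p + c * q ->
  exists t1 t2, t = a * t1 + c * t2.

(** Grouping by [b] and [d] gives [p a + q c = d t] and [r c + s a = - b t]. Then [t] lies in
    [(a, c)], and subtracting its two parts leaves Koszul relations between [a] and [c]. The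
    parameters are the coefficients of the rows of [c4_diff 1]. *)
Lemma c4_syzygies p q r s :
  p * (a * b) + q * (b * c) + r * (c * d) + s * (d * a) = 0 ->
  exists k t1 t2 l, [/\ p = k * c + t1 * d, q = - (k * a) + t2 * d,
     r = - (t2 * b) + l * a & s = - (t1 * b) - l * c].
Proof.
move=> E.
have [|t [E1 E2]] := @reg_pair_syzygy _ _ (p * a + q * c) (r * c + s * a) reg_bd.
  by rewrite -E; ring.
have [t1 [t2 Et]] : exists t1 t2, t = a * t1 + c * t2.
  by apply: (reg_acd (p := p) (q := q)); rewrite -E1; ring.
have [|k [Ep Eq]] := @reg_pair_syzygy _ _ (p - t1 * d) (q - t2 * d) reg_ac.
  have -> : a * (p - t1 * d) + c * (q - t2 * d) =
     (p * a + q * c) - d * (a * t1 + c * t2) by ring.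
  by rewrite E1 Et subrr.
have [|l [Es Er]] := @reg_pair_syzygy _ _ (s + t1 * b) (r + t2 * b) reg_ac.
  have -> : a * (s + t1 * b) + c * (r + t2 * b) =
     (r * c + s * a) + b * (a * t1 + c * t2) by ring.
  by rewrite E2 Et addNr.
exists k, t1, t2, (- l); split.
- by rewrite -[p](subrK (t1 * d)) Ep; ring.
- by rewrite -[q](subrK (t2 * d)) Eq; ring.
- by rewrite -[r](addrK (t2 * b)) Er; ring.
- by rewrite -[s](addrK (t1 * b)) Es; ring.
Qed.

Lemma c4_syzygies2 k t1 t2 l :
  k * c + t1 * d = 0 -> - (k * a) + t2 * d = 0 -> - (t2 * b) + l * a = 0 ->
  exists m, [/\ k = m * d, t1 = - (m * c), t2 = m * a & l = m * b].
Proof.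
move=> E1 E2 E3; have [|m [Ek Et2]] := reg_ad (p := k) (q := t2).
  by rewrite -[RHS]addr0 -[in RHS]oppr0 -E2; ring.
exists m; split; [by rewrite Ek mulrC| |by rewrite Et2 mulrC|].
  apply/eqP; rewrite -subr_eq0 -(mulrI_eq0 _ (mulfI d0)); apply/eqP.
  by rewrite -[RHS]E1 Ek; ring.
apply/eqP; rewrite -subr_eq0 -(mulrI_eq0 _ (mulfI a0)); apply/eqP.
by rewrite -[RHS]E3 Et2; ring.
Qed.

Lemma c4_exact i (v : 'rV_(c4_rank i.+1)) :
  v *m c4_diff i = 0 <-> exists w, v = w *m c4_diff i.+1.
Proof.
split=> [|[w ->]]; last first.
  rewrite -mulmxA; suff -> : c4_diff i.+1 *m c4_diff i = 0 by rewrite mulmx0.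
  case: i {v w} => [|[|i]]; last exact: mul0mx.
    apply/matrixP=> -[[|[|[|[|//]]]] ? [[|//] ?]];
      by rewrite !mxE /= !big_ord_recl big_ord0 !mxE /=; ring.
  apply/matrixP=> -[[|//] ? [[|[|[|[|//]]]] ?]];
    by rewrite !mxE /= !big_ord_recl big_ord0 !mxE /=; ring.
case: i v => [|[|[|i]]] v.
- have [[|p [|q [|r [|s []]]]] // _ ->] := seq_rowP v.
  move/matrixP/(_ 0 0); rewrite !mxE !big_ord_recl big_ord0 !mxE /= addr0 !addrA.
  case/c4_syzygies=> k [t1 [t2 [l [-> -> -> ->]]]].
  exists (seq_mx [:: [:: k; t1; t2; l]] 1 4); apply/rowP=> -[[|[|[|[|//]]]] ?];
    by rewrite !mxE /= !big_ord_recl big_ord0 !mxE /=; ring.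
- have [[|k [|t1 [|t2 [|l []]]]] // _ ->] := seq_rowP v.
  move/matrixP=> E; have := (E 0 (inord 0), E 0 (inord 1), E 0 (inord 2)).
  rewrite !mxE !big_ord_recl !big_ord0 !mxE /= !inordK //= !mulr0 !addr0 !add0r.
  rewrite !mulrN => -[[E1 E2] E3].
  have [m [-> -> -> ->]] := c4_syzygies2 E1 E2 E3.
  exists (seq_mx [:: [:: m]] 1 1); apply/rowP=> -[[|[|[|[|//]]]] ?];
    by rewrite !mxE /= !big_ord_recl big_ord0 !mxE /=; ring.
- have [[|m []] // _ ->] := seq_rowP v.
  move/matrixP/(_ 0 0); rewrite !mxE big_ord_recl big_ord0 !mxE /= addr0 => /eqP.
  rewrite mulf_eq0 (negPf d0) orbF => /eqP->; exists 0; rewrite mul0mx.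
  by apply/rowP=> -[[|//] ?]; rewrite !mxE.
- by move=> _; exists 0; apply/rowP=> -[].
Qed.

End FourCycleComplex.

Section KoszulPair.
Variables f g : R.

Definition ci2_rank i := match i with 0 => 1 | 1 => 2 | 2 => 1 | _ => 0 end%N.

Definition ci2_diff i : 'M[R]_(ci2_rank i.+1, ci2_rank i) :=
  match i return 'M[R]_(ci2_rank i.+1, ci2_rank i) with
  | 0 => seq_mx [:: [:: f]; [:: g]] 2 1
  | 1 => seq_mx [:: [:: g; - f]] 1 2
  | _ => 0
  end.

Hypotheses (g0 : g != 0) (reg_fg : reg_pair f g).

Lemma ci2_exact i (v : 'rV_(ci2_rank i.+1)) :
  v *m ci2_diff i = 0 <-> exists w, v = w *m ci2_diff i.+1.
Proof.
split=> [|[w ->]]; last first.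
  rewrite -mulmxA; suff -> : ci2_diff i.+1 *m ci2_diff i = 0 by rewrite mulmx0.
  case: i {v w} => [|i]; last exact: mul0mx.
  apply/matrixP=> -[[|//] ? [[|//] ?]];
    by rewrite !mxE /= !big_ord_recl big_ord0 !mxE /=; ring.
case: i v => [|[|i]] v.
- have [[|p [|q []]] // _ ->] := seq_rowP v.
  move/matrixP/(_ 0 0); rewrite !mxE !big_ord_recl big_ord0 !mxE /= addr0.
  rewrite [p * f]mulrC [q * g]mulrC.
  case/(reg_pair_syzygy reg_fg)=> r [-> ->].
  exists (seq_mx [:: [:: r]] 1 1); apply/rowP=> -[[|[|//]] ?];
    by rewrite !mxE /= !big_ord_recl big_ord0 !mxE /=; ring.
- have [[|m []] // _ ->] := seq_rowP v.
  move/matrixP/(_ 0 0); rewrite !mxE big_ord_recl big_ord0 !mxE /= addr0 => /eqP.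
  rewrite mulf_eq0 (negPf g0) orbF => /eqP->; exists 0; rewrite mul0mx.
  by apply/rowP=> -[[|//] ?]; rewrite !mxE.
- by move=> _; exists 0; apply/rowP=> -[].
Qed.

End KoszulPair.
End AbstractComplexes.

(** * Pure resolutions and their Betti numbers *)

Section PureResolution.
Variables (n : nat) (F : fieldType) (I : {mpoly F[n]} -> Prop).
Local Notation S := {mpoly F[n]}.
Variables (rk dg : nat -> nat) (aug : 'cV[S]_(rk 0)).
Variable diff : forall i, 'M[S]_(rk i.+1, rk i).
Hypothesis dg_incr : forall i, (dg i < dg i.+1)%N.
Hypothesis aug_homog : forall a, aug a 0 \is (dg 0).-homog.
Hypothesis diff_homog : forall i a b, diff i a b \is (dg i.+1 - dg i).-homog.
Hypothesis aug_onto : forall p, exists v : 'rV_(rk 0), I (p - (v *m aug) 0 0).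
Hypothesis exact0 : forall v : 'rV_(rk 0),
  I ((v *m aug) 0 0) <-> exists w, v = w *m diff 0.
Hypothesis exactS : forall i (v : 'rV_(rk i.+1)),
  v *m diff i = 0 <-> exists w, v = w *m diff i.+1.

Lemma pure_diff_eq0 i (a : 'I_(rk i.+1)) (b : 'I_(rk i)) :
  (dg i.+1 < dg i)%N -> diff i a b = 0.
Proof. by move/(ltn_trans (dg_incr i)); rewrite ltnn. Qed.

Definition pure_resolution : graded_resolution I :=
  @GradedResolution _ _ I rk (fun i _ => dg i) aug diff aug_homog
    (fun i a b _ => diff_homog a b) pure_diff_eq0 aug_onto exact0 exactS.

(** Strictly increasing degrees make every entry of the differentials homogeneous of positive
    degree, so the differentials become zero over [F] and the Betti numbers are the ranks. *)
Lemma tor_dim_pure_resolution i j :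
  tor_dim pure_resolution i j = ((dg i == j) * rk i)%N.
Proof.
have diff0 k : tor_diff pure_resolution k = 0.
  apply/matrixP=> a b; rewrite !mxE (dhomog_nemf_coeff (diff_homog a b)) //=.
  by rewrite mdeg0 eq_sym -lt0n subn_gt0.
have deg k : \rank (deg_part pure_resolution k j) = ((dg k == j) * rk k)%N.
  have -> : deg_part pure_resolution k j = ((dg k == j)%:R)%:M.
    by apply/matrixP=> a b; rewrite !mxE /=; case: (dg k == j); case: (a == b).
  by case: (dg k == j); rewrite ?mxrank1 ?mul1n // raddf0 mxrank0.
rewrite /tor_dim /tor_boundaries diff0 mulmx0 mxrank0 subn0 -deg.
case: i => [//|i] /=; rewrite diff0; apply/eqmx_rank/eqmxP/capmx_idPl.
by apply/sub_kermxP; rewrite mulmx0.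
Qed.

End PureResolution.

Section IdealGenSeq.
Variable R : comNzRingType.

Lemma ideal_gen_seqP (s : seq R) m p : size s = m ->
  ideal_gen (fun q => q \in s) p <->
  exists w : 'rV[R]_m, p = (w *m seq_mx [seq [:: q] | q <- s] m 1) 0 0.
Proof.
move=> sz; split=> [|[w ->]].
  pose G := seq_mx [seq [:: q] | q <- s] m 1.
  apply: (ideal_gen_min (J := fun p => exists w : 'rV_m, p = (w *m G) 0 0)).
    split.
    - by exists 0; rewrite mul0mx mxE.
    - by move=> _ _ [v ->] [w ->]; exists (v + w); rewrite mulmxDl [RHS]mxE.
    - by move=> x _ [w ->]; exists (x *: w); rewrite -scalemxAl [RHS]mxE.
  move=> {}p ps.
  have lt_i : (index p s < m)%N by rewrite -sz index_mem.
  exists (delta_mx 0 (Ordinal lt_i)).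
  by rewrite -rowE !mxE /= (nth_map 0) ?index_mem //= nth_index.
rewrite mxE; apply: is_ideal_sum => [|i _]; first exact: ideal_gen_is_ideal.
apply: is_idealMl; first exact: ideal_gen_is_ideal.
by apply: ideal_gen_mem; rewrite mxE /= (nth_map 0) ?sz //= mem_nth ?sz.
Qed.

End IdealGenSeq.

(** * Regular sequences made of variables *)

Section Variables.
Variables (F : fieldType) (V : finType).
Local Notation S := {mpoly F[#|V|]}.
Local Notation X := (xvar F).
Implicit Types (a b c d v : V) (p q t : S).

Definition vanish_on (A : {set V}) v : S := if v \in A then 0 else X v.

Lemma vanish_onP A p : msubst (vanish_on A) p = 0 ->
  exists q : V -> S, p = \sum_(v in A) X v * q v.
Proof.
move=> p0; have [q] := subr_msubst (vanish_on A) p; rewrite p0 subr0 => ->.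
exists q; rewrite [RHS]big_mkcond; apply: eq_bigr => v _; rewrite /vanish_on.
by case: (v \in A); rewrite ?subrr ?mulr0 // subr0 mulrC.
Qed.

Lemma vanish_onX A v : msubst (vanish_on A) (X v) = if v \in A then 0 else X v.
Proof. exact: msubst_var. Qed.

(** Setting [x_b] to 0 leaves [x_a p = 0] in a domain. *)
Lemma xvar_dvd a b p q : a != b -> X a * p = X b * q -> exists r, p = X b * r.
Proof.
move=> ab /(congr1 (msubst (vanish_on [set b]))) /eqP.
rewrite !rmorphM /= !vanish_onX !inE eqxx (negPf ab) mul0r mulf_eq0 xvar_eq0 /=.
move=> /eqP/vanish_onP[r ->]; exists (r b).
by rewrite big_set1.
Qed.

Lemma xvar_reg_pair a b : a != b -> reg_pair (X a) (X b).
Proof.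
move=> ab p q E; have [r Ep] := xvar_dvd ab E; exists r; split=> //.
have Xb0 : X b != 0 by rewrite xvar_eq0.
by apply: (mulfI Xb0); rewrite -E Ep mulrCA.
Qed.

Lemma xvar_reg_triple a c d t p q : a != c -> d != a -> d != c ->
  X d * t = X a * p + X c * q -> exists t1 t2, t = X a * t1 + X c * t2.
Proof.
move=> ac da dc /(congr1 (msubst (vanish_on [set a; c]))) /eqP.
rewrite rmorphD !rmorphM /= !vanish_onX !inE !eqxx (negPf da) (negPf dc) orbT.
rewrite !mul0r addr0 mulf_eq0 xvar_eq0 => /eqP/vanish_onP[r ->].
by exists (r a), (r c); rewrite big_setU1 ?inE //= big_set1.
Qed.

(** Dividing off one variable at a time shows that [x_b], and then [x_d], divides [p]. *)
Lemma xvarM_reg_pair a b c d : uniq [:: a; b; c; d] ->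
  reg_pair (X a * X c) (X b * X d).
Proof.
move=> /= /and4P[]; rewrite !inE !negb_or => /and3P[ab _ ad] /andP[bc _] cd _.
move=> p q; rewrite -!mulrA => E.
have [r1 E1] := xvar_dvd ab E.
have cb : c != b by rewrite eq_sym.
have [p1 Ep1] := xvar_dvd cb E1.
have Xb0 : X b != 0 by rewrite xvar_eq0.
have E2 : X a * (X c * p1) = X d * q.
  by apply: (mulfI Xb0); rewrite -E Ep1 [X c * (X b * _)]mulrCA [RHS]mulrCA.
have [r2 E3] := xvar_dvd ad E2; have [r Er] := xvar_dvd cd E3.
exists r; rewrite Ep1 Er -mulrA; split=> //.
have Xd0 : X d != 0 by rewrite xvar_eq0.
by apply: (mulfI Xd0); rewrite -E2 Er -mulrA [X c * (X d * r)]mulrCA [LHS]mulrCA.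
Qed.

Lemma xvar_homog v : X v \is 1.-homog.
Proof. by rewrite dhomogX /= mdeg1. Qed.

Lemma xvarM_homog u v : X u * X v \is 2.-homog.
Proof. exact: dhomogM (xvar_homog u) (xvar_homog v). Qed.

Lemma prod_xvar_dvd (A : {set V}) u v : u != v -> u \in A -> v \in A ->
  exists q, \prod_(w in A) X w = q * (X u * X v).
Proof.
move=> uv uA vA; exists (\prod_(w in A :\ u :\ v) X w).
have vAu : v \in A :\ u by rewrite !inE eq_sym uv.
by rewrite (big_setD1 u uA) (big_setD1 v vAu) /= mulrA mulrC.
Qed.

End Variables.

(** * The two Stanley-Reisner ideals of a 4-cycle *)

Section FourCycle.
Variables (F : fieldType) (V : finType) (G : sgraph V) (a b c d : V).
Local Notation S := {mpoly F[#|V|]}.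
Local Notation X := (xvar F).
Local Notation D := (total_cut 2 G).
Local Notation K := (alexander_dual D).
Hypothesis uniq_abcd : uniq [:: a; b; c; d].
Hypothesis all_abcd : forall v, v \in [:: a; b; c; d].
Hypotheses (Gab : G a b) (Gbc : G b c) (Gcd : G c d) (Gda : G d a).
Hypotheses (Gac : ~~ G a c) (Gbd : ~~ G b d).

Let neq_abcd : [/\ a != b, a != c, a != d, b != c & b != d /\ c != d].
Proof.
by move: uniq_abcd; rewrite /= !inE !negb_or => /and4P[/and3P[-> -> ->] /andP[-> ->] -> _].
Qed.

Lemma four_cycle_nonadjacent u v : u != v -> ~~ G u v ->
  [set u; v] = [set a; c] \/ [set u; v] = [set b; d].
Proof.
have GC x y : G x y -> G y x by rewrite (@adj_sym _ G).
have := all_abcd u; have := all_abcd v; rewrite !inE.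
by case/or4P=> /eqP-> /or4P[]/eqP->;
  rewrite ?eqxx ?Gab ?Gbc ?Gcd ?Gda ?(GC _ _ Gab) ?(GC _ _ Gbc) ?(GC _ _ Gcd)
    ?(GC _ _ Gda) // => _ _; auto; rewrite setUC; auto.
Qed.

Lemma total_cut_four_cycle A :
  (A \in faces D) = (a \notin A) && (c \notin A) || (b \notin A) && (d \notin A).
Proof.
have [_ ac _ _ [bd _]] := neq_abcd.
apply/total_cut2P/orP=> [[u [v [uv Guv uA vA]]]|].
  have out x : x \in [set u; v] -> x \notin A by case/set2P=> ->.
  by have [E|E] := four_cycle_nonadjacent uv Guv; [left|right];
    rewrite !out // E !inE eqxx ?orbT.
by case=> /andP[]; [exists a, c|exists b, d].
Qed.

Lemma xvarM_sr_ideal (B : scomplex V) u v : u != v -> [set u; v] \notin faces B ->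
  sr_ideal F B (X u * X v).
Proof.
move=> uv uvB; apply: ideal_gen_mem; exists [set u; v] => //.
by rewrite big_setU1 ?inE //= big_set1.
Qed.

Definition cycle_edges : seq S := [:: X a * X b; X b * X c; X c * X d; X d * X a].

Definition cycle_diagonals : seq S := [:: X a * X c; X b * X d].

(** A nonface meets both diagonals, hence contains an edge of the cycle; conversely every edge meets
    both diagonals. *)
Lemma sr_ideal_four_cycle p :
  sr_ideal F D p <-> ideal_gen (fun q => q \in cycle_edges) p.
Proof.
have [ab ac ad bc [bd cd]] := neq_abcd; have da : d != a by rewrite eq_sym.
split; move: p; apply: ideal_gen_min; try exact: ideal_gen_is_ideal.
  move=> _ [A + ->]; rewrite total_cut_four_cycle negb_or.
  rewrite !negb_and !negbK.
  have gen u v : u != v -> u \in A -> v \in A -> X u * X v \in cycle_edges ->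
      ideal_gen (fun q => q \in cycle_edges) (\prod_(w in A) X w).
    move=> uv uA vA uvE; have [q ->] := prod_xvar_dvd F uv uA vA.
    by apply: is_idealMl; [exact: ideal_gen_is_ideal|exact: ideal_gen_mem].
  case/andP=> /orP[aA|cA] /orP[bA|dA].
  - by apply: (gen a b); rewrite // !inE eqxx.
  - by apply: (gen d a); rewrite // !inE eqxx ?orbT.
  - by apply: (gen b c); rewrite // !inE eqxx ?orbT.
  - by apply: (gen c d); rewrite // !inE eqxx ?orbT.
have edge u v : u != v -> (u \in [set a; c]) || (v \in [set a; c]) ->
    (u \in [set b; d]) || (v \in [set b; d]) -> sr_ideal F D (X u * X v).
  move=> uv uvac uvbd; apply: xvarM_sr_ideal => //; rewrite total_cut_four_cycle.
  rewrite negb_or !negb_and !negbK; move: uvac uvbd; rewrite !inE.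
  by rewrite ![_ == u]eq_sym ![_ == v]eq_sym; do 8!case: (_ == _).
move=> q; rewrite !inE => /or4P[]/eqP->; apply: edge; rewrite // !inE ?eqxx ?orbT //.
Qed.

Lemma sr_ideal_dual_four_cycle p :
  sr_ideal F K p <-> ideal_gen (fun q => q \in cycle_diagonals) p.
Proof.
have [_ ac _ _ [bd _]] := neq_abcd.
split; move: p; apply: ideal_gen_min; try exact: ideal_gen_is_ideal.
  move=> _ [A + ->]; rewrite inE negbK => /total_cut2P[u [v [uv Guv]]].
  rewrite !inE !negbK => uA vA.
  have uvA : [set u; v] \subset A by rewrite subUset !sub1set uA.
  have gen x y : x != y -> [set x; y] \subset A -> X x * X y \in cycle_diagonals ->
      ideal_gen (fun q => q \in cycle_diagonals) (\prod_(w in A) X w).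
    rewrite subUset !sub1set => xy /andP[xA yA] xyE.
    have [q ->] := prod_xvar_dvd F xy xA yA.
    by apply: is_idealMl; [exact: ideal_gen_is_ideal|exact: ideal_gen_mem].
  have [E|E] := four_cycle_nonadjacent uv Guv; rewrite E in uvA.
    by apply: (gen a c); rewrite // !inE eqxx.
  by apply: (gen b d); rewrite // !inE eqxx orbT.
move=> q; rewrite !inE => /orP[]/eqP->; apply: xvarM_sr_ideal => //.
  by rewrite dual_total_cut2_pair negb_or ac.
by rewrite dual_total_cut2_pair negb_or bd.
Qed.

Lemma cycle_diagonals_regular_seq : regular_seq (fun p : S => p = 0) cycle_diagonals.
Proof.
have reg := xvarM_reg_pair (F := F) uniq_abcd.
have zero_ideal : is_ideal (fun p : S => p = 0).
  by split=> // [p q -> ->|p q ->]; rewrite ?addr0 ?mulr0.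
split=> [[|[|//]] g _ /=|].
- move=> /(ideal_add0 zero_ideal)/eqP; rewrite !mulf_eq0 !xvar_eq0 !orbF.
  by move/eqP->; exact: (is_ideal0 (ideal_add_is_ideal _ _ _)).
- move=> /(@ideal_addS _ _ cycle_diagonals 0 _ isT)[q] /(ideal_add0 zero_ideal)/eqP.
  rewrite subr_eq0 /= mulrC => /eqP/esym/reg[r [_ ->]].
  rewrite mulrC; apply: is_idealMl; first exact: ideal_add_is_ideal.
  by apply: ideal_gen_mem; right; rewrite /= mem_head.
(* Evaluation at the origin kills both generators but not 1. *)
- move=> one; have := msubst_ker_ideal (fun _ : V => 0 : S).
  move/ideal_gen_min => /(_ _ _ _ one); rewrite /msubst_ker rmorph1 => H.
  have /eqP : 1 = 0 :> S; last by rewrite oner_eq0.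
  apply: H => p [->|]; first by rewrite rmorph0.
  by rewrite !inE => /orP[]/eqP->; rewrite rmorphM /= !msubst_var mulr0.
Qed.

End FourCycle.

(** * Betti numbers for the 4-cycle *)

Section FourCycleBetti.
Variables (F : fieldType) (V : finType) (G : sgraph V) (a b c d : V).
Local Notation S := {mpoly F[#|V|]}.
Local Notation X := (xvar F).
Local Notation D := (total_cut 2 G).
Local Notation K := (alexander_dual D).
Hypothesis uniq_abcd : uniq [:: a; b; c; d].
Hypothesis all_abcd : forall v, v \in [:: a; b; c; d].
Hypotheses (Gab : G a b) (Gbc : G b c) (Gcd : G c d) (Gda : G d a).
Hypotheses (Gac : ~~ G a c) (Gbd : ~~ G b d).

Let aug : 'cV[S]_1 := seq_mx [:: [:: 1]] 1 1.

Let augE (v : 'rV_1) : (v *m aug) 0 0 = v 0 0.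
Proof. by rewrite mxE big_ord1 !mxE /= mulr1. Qed.

Let aug_homog i : aug i 0 \is 0.-homog.
Proof. by rewrite mxE ord1 /= dhomog1. Qed.

Let aug_onto I p : is_ideal I -> exists v : 'rV_1, I (p - (v *m aug) 0 0).
Proof.
by move=> HI; exists (const_mx p); rewrite augE mxE subrr; apply: is_ideal0.
Qed.

Let aug_exact I (s : seq S) m (M : 'M_(m, 1)) (v : 'rV_1) : size s = m ->
  (forall p, I p <-> ideal_gen (fun q => q \in s) p) ->
  M = seq_mx [seq [:: q] | q <- s] m 1 ->
  I ((v *m aug) 0 0) <-> exists w, v = w *m M.
Proof.
move=> sz_s IE ->; rewrite augE IE (ideal_gen_seqP _ sz_s).
split=> -[w Ew]; exists w; last by rewrite Ew.
by apply/rowP=> j; rewrite ord1 Ew.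
Qed.

Let neq_abcd : [/\ a != b, a != c, a != d, b != c & b != d /\ c != d].
Proof.
by move: uniq_abcd; rewrite /= !inE !negb_or => /and4P[/and3P[-> -> ->] /andP[-> ->] -> _].
Qed.

(** The shifts 0, 2, 3, 4 of a 2-linear resolution; later values belong to modules of rank 0. *)
Let c4_dg i := if i is 0 then 0%N else i.+1.

Lemma c4_resolution : exists C : graded_resolution (sr_ideal F D),
  forall i j, tor_dim C i j = ((c4_dg i == j) * c4_rank i)%N.
Proof.
have [ab ac ad bc [bd cd]] := neq_abcd; have da : d != a by rewrite eq_sym.
have dc : d != c by rewrite eq_sym.
have X0 (v : V) : X v != 0 by rewrite xvar_eq0.
have incr i : (c4_dg i < c4_dg i.+1)%N by case: i.
have diff_homog i e f : c4_diff (X a) (X b) (X c) (X d) i e f \is (c4_dg i.+1 - c4_dg i).-homog.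
  have hX := @xvar_homog F V; have hXX := @xvarM_homog F V.
  case: i e f => [|[|[|i]]]; last by case.
  - by move=> [[|[|[|[|//]]]] ?] [[|//] ?]; rewrite mxE /=.
  - by move=> [[|[|[|[|//]]]] ?] [[|[|[|[|//]]]] ?]; rewrite mxE /= ?rpredN ?rpred0.
  - by move=> [[|//] ?] [[|[|[|[|//]]]] ?]; rewrite mxE /= ?rpredN ?rpred0.
have onto p := aug_onto p (sr_ideal_is_ideal F D).
have exact0 v := @aug_exact _ (cycle_edges F a b c d) 4
  (c4_diff (X a) (X b) (X c) (X d) 0) v erefl
  (sr_ideal_four_cycle uniq_abcd all_abcd Gab Gbc Gcd Gda Gac Gbd) erefl.
have exactS := c4_exact (X0 a) (X0 d) (xvar_reg_pair ac) (xvar_reg_pair bd)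
  (xvar_reg_pair ad) (fun t p q => xvar_reg_triple ac da dc).
exists (@pure_resolution _ _ _ c4_rank c4_dg aug _ incr aug_homog diff_homog onto exact0 exactS).
exact: tor_dim_pure_resolution.
Qed.

Lemma ci2_resolution : exists C : graded_resolution (sr_ideal F K),
  forall i j, tor_dim C i j = ((i.*2 == j) * ci2_rank i)%N.
Proof.
have incr i : (i.*2 < i.+1.*2)%N by rewrite ltn_double.
have diff_homog i e f : ci2_diff (X a * X c) (X b * X d) i e f \is (i.+1.*2 - i.*2).-homog.
  have hXX := @xvarM_homog F V; have -> : (i.+1.*2 - i.*2 = 2)%N by lia.
  case: i e f => [|[|i]]; last by case.
  - by move=> [[|[|//]] ?] [[|//] ?]; rewrite mxE /=.
  - by move=> [[|//] ?] [[|[|//]] ?]; rewrite mxE /= ?rpredN.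
have onto p := aug_onto p (sr_ideal_is_ideal F K).
have exact0 v := @aug_exact _ (cycle_diagonals F a b c d) 2
  (ci2_diff (X a * X c) (X b * X d) 0) v erefl
  (sr_ideal_dual_four_cycle uniq_abcd all_abcd Gab Gbc Gcd Gda Gac Gbd) erefl.
have nz : X b * X d != 0 by rewrite mulf_neq0 ?xvar_eq0.
have exactS := ci2_exact nz (xvarM_reg_pair uniq_abcd).
exists (@pure_resolution _ _ _ ci2_rank double aug _ incr aug_homog diff_homog onto exact0 exactS).
exact: tor_dim_pure_resolution.
Qed.

Lemma betti_numbers_four_cycle :
  betti_numbers (sr_ideal F D)
    [:: ((0, 0), 1); ((1, 2), 4); ((2, 3), 4); ((3, 4), 1)]%N.
Proof.
have [C CE] := c4_resolution; move=> i j; exists C; rewrite CE !big_cons big_nil /=.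
rewrite !xpair_eqE; case: i => [|[|[|[|i]]]] /=; rewrite ?muln0 //;
  by rewrite eq_sym; case: eqP.
Qed.

Lemma betti_numbers_dual_four_cycle :
  betti_numbers (sr_ideal F K) [:: ((0, 0), 1); ((1, 2), 2); ((2, 4), 1)]%N.
Proof.
have [C CE] := ci2_resolution; move=> i j; exists C; rewrite CE !big_cons big_nil /=.
rewrite !xpair_eqE; case: i => [|[|[|i]]] /=; rewrite ?muln0 //;
  by rewrite eq_sym; case: eqP.
Qed.

Lemma linear_resolution_four_cycle : has_linear_resolution (sr_ideal F D).
Proof.
have gens := sr_ideal_four_cycle uniq_abcd all_abcd Gab Gbc Gcd Gda Gac Gbd.
have hXX := @xvarM_homog F V; exists 2%N => //; split=> [p|i j i1 ne].
  split=> [/gens Ip|]; last first.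
    apply: ideal_gen_min p; first exact: sr_ideal_is_ideal.
    by move=> p [].
  apply: ideal_gen_min p Ip; first exact: ideal_gen_is_ideal.
  move=> p p_edge; apply: ideal_gen_mem; split; first by apply/gens/ideal_gen_mem.
  by move: p_edge; rewrite !inE => /or4P[]/eqP->.
have [C CE] := c4_resolution; exists C; rewrite CE.
case: i i1 ne => [//|i] _ ne; case: eqP => // E; case: ne; rewrite -E /=; lia.
Qed.

End FourCycleBetti.

(** * Cyclic orders on the prism over two indices, and the two parts of the theorem *)

Lemma prism2_ucycle (x1 x2 x3 x4 : bool * 'I_2) :
  ucycle (K2K 2) [:: x1; x2; x3; x4] ->
  [/\ uniq [:: x1; x2; x3; x4], forall v, v \in [:: x1; x2; x3; x4],
      [/\ K2K 2 x1 x2, K2K 2 x2 x3, K2K 2 x3 x4 & K2K 2 x4 x1],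
      ~~ K2K 2 x1 x3 & ~~ K2K 2 x2 x4].
Proof.
case/andP=> /= /and5P[E1 E2 E3 E4 _] U.
(* Adjacent vertices differ in exactly one of two two-valued coordinates, so two steps change an
   even number of them. *)
have alt u v w : K2K 2 u v -> K2K 2 v w -> ~~ K2K 2 u w.
  have I2 (i : 'I_2) : i = ord0 \/ i = ord_max.
    by case: i => [[|[|//]] lt_i]; [left|right]; apply: val_inj.
  case: u v w => [e i] [f j] [g k]; rewrite !K2KE /=.
  case: e f g => [] [] []; case: (I2 i) => ->; case: (I2 j) => ->; case: (I2 k) => ->; by [].
split=> //; try exact: alt E1 E2; try exact: alt E2 E3.
(* Four distinct vertices exhaust a set of four. *)
have sub := @uniq_min_size _ [:: x1; x2; x3; x4] (enum {: bool * 'I_2}) U.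
have [||_ E] := sub; first by move=> v _; rewrite mem_enum.
  by rewrite -cardE card_prod card_bool card_ord.
by move=> v; rewrite E mem_enum.
Qed.

Lemma prism2_ucycle_exists :
  exists x1 x2 x3 x4 : bool * 'I_2, ucycle (K2K 2) [:: x1; x2; x3; x4].
Proof. by exists (false, ord0), (false, ord_max), (true, ord_max), (true, ord0). Qed.

Theorem theorem19 (F : fieldType) :
  (* (1) *)
  [/\ has_linear_resolution (sr_ideal F (total_cut 2 (K2K 2))),
      betti_numbers (sr_ideal F (total_cut 2 (K2K 2)))
        [:: ((0, 0), 1); ((1, 2), 4); ((2, 3), 4); ((3, 4), 1)]%N,
      (exists x1 x2 x3 x4 : bool * 'I_2, ucycle (K2K 2) [:: x1; x2; x3; x4]),
      (forall x1 x2 x3 x4 : bool * 'I_2, ucycle (K2K 2) [:: x1; x2; x3; x4] ->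
         (forall p : {mpoly F[#|{: bool * 'I_2}|]},
            sr_ideal F (alexander_dual (total_cut 2 (K2K 2))) p <->
            ideal_gen (fun q => q \in [:: xvar F x1 * xvar F x3;
                                          xvar F x2 * xvar F x4]) p)
         /\ regular_seq (fun p : {mpoly F[#|{: bool * 'I_2}|]} => p = 0)
              [:: xvar F x1 * xvar F x3; xvar F x2 * xvar F x4]) &
      betti_numbers (sr_ideal F (alexander_dual (total_cut 2 (K2K 2))))
        [:: ((0, 0), 1); ((1, 2), 2); ((2, 4), 1)]%N]
  /\
  (* (2) *)
  (forall n : nat, (2 < n)%N ->
     [/\ ~ cohen_macaulay (sr_ideal F (total_cut 2 (K2K n))),
         ~ cohen_macaulay (sr_ideal F (alexander_dual (total_cut 2 (K2K n)))),
         ~ has_linear_resolution (sr_ideal F (total_cut 2 (K2K n))) &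
         ~ has_linear_resolution
             (sr_ideal F (alexander_dual (total_cut 2 (K2K n))))]).
Proof.
split.
  have [x1 [x2 [x3 [x4 cyc]]]] := prism2_ucycle_exists.
  have [U all4 [E12 E23 E34 E41] N13 N24] := prism2_ucycle cyc.
  split.
  - exact: (linear_resolution_four_cycle F U all4 E12 E23 E34 E41 N13 N24).
  - exact: (betti_numbers_four_cycle F U all4 E12 E23 E34 E41 N13 N24).
  - exact: prism2_ucycle_exists.
  - move=> {cyc U all4 E12 E23 E34 E41 N13 N24} {}x1 {}x2 {}x3 {}x4.
    case/prism2_ucycle=> U all4 [E12 E23 E34 E41] N13 N24; split.
      exact: (sr_ideal_dual_four_cycle U all4 E12 E23 E34 E41 N13 N24).
    exact: (cycle_diagonals_regular_seq F U).
  - exact: (betti_numbers_dual_four_cycle F U all4 E12 E23 E34 E41 N13 N24).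
move=> n n2; have i01 : Ordinal (ltnW (ltnW n2)) != Ordinal (ltnW n2) by [].
split.
- exact: (not_cohen_macaulay_prism i01).
- exact: (not_cohen_macaulay_dual_prism i01 n2).
- exact: (not_linear_prism i01 n2).
- exact: (not_linear_dual_prism i01).
Qed.
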